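(* Let $p$ be a prime number, let $R$ be a Noetherian ring and let $A$ be a perfectoid $R$-algebra. Let $I$ be an ideal of $R$ such that $p \in I$ and $I$ is generated by $r$ elements up to radical. Then: (1) The projective dimension satisfies $\mathrm{pd}_A(A/\sqrt{IA}) \le 2(r+1)$. (2) If $\mathrm{idim}_R(A)$ is finite, then $\mathrm{idim}_R(A/\sqrt{IA}) \le \mathrm{idim}_R(A)$.
   Context: Rings are commutative with $1$; $\mathrm{pd}$ and $\mathrm{idim}$ denote projective and injective dimension. ''$I$ is generated by $r$ elements up to radical'' means there are $f_1,\dots,f_r\in R$ with $\sqrt{I}=\sqrt{(f_1,\dots,f_r)}$. $\sqrt{IA}$ is the radical in $A$ of the extended ideal $IA$. A ring $A$ is perfectoid (with respect to $p$) if: there is $\pi\in A$ such that $\pi^p$ divides $p$ and $A$ is $\pi$-adically complete (and separated); the Frobenius $A/pA\to A/pA$ is surjective; and the kernel of Fontaine's map $\theta\colon W(A^\flat)\to A$ is principal, where $A^\flat=\varprojlim_{x\mapsto x^p}A/pA$. A perfectoid $R$-algebra is an $R$-algebra that is perfectoid as a ring. *)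

(* Defs.v *)
From HB Require Import structures.
From mathcomp Require Import all_boot all_order all_algebra.
From mathcomp Require Import finmap.
From mathcomp Require Import boolp classical_sets functions.
From mathcomp Require Import monalg.

Set Implicit Arguments.
Unset Strict Implicit.
Unset Printing Implicit Defensive.
Import GRing.Theory.

Local Open Scope classical_set_scope.
Local Open Scope ring_scope.
Local Open Scope quotient_scope.

(* Rings are [comPzRingType]s: the zero ring is allowed. The library's [idealr]
   is not usable here, as it only covers proper ideals of nontrivial rings. *)
Record ideal (R : comPzRingType) := Ideal {
  ideal_set :> R -> Prop;
  ideal0 : ideal_set 0;
  idealD : forall x y, ideal_set x -> ideal_set y -> ideal_set (x + y);
  idealMl : forall a x, ideal_set x -> ideal_set (a * x)
}.

Section Ideals.
Variable R : comPzRingType.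
Implicit Types (I J : ideal R) (S : set R).

Lemma idealN I x : I x -> I (- x).
Proof. by rewrite -mulN1r; apply: idealMl. Qed.

Lemma idealB I x y : I x -> I y -> I (x - y).
Proof. by move=> Ix Iy; apply: idealD => //; apply: idealN. Qed.

Definition gen_ideal_set S : set R :=
  fun x => forall J, S `<=` ideal_set J -> J x.

Fact gen_ideal0 S : gen_ideal_set S 0.
Proof. by move=> J _; apply: ideal0. Qed.

Fact gen_idealD S x y :
  gen_ideal_set S x -> gen_ideal_set S y -> gen_ideal_set S (x + y).
Proof.
by move=> Sx Sy J SJ; apply: idealD; [apply: Sx | apply: Sy].
Qed.

Fact gen_idealMl S a x : gen_ideal_set S x -> gen_ideal_set S (a * x).
Proof. by move=> Sx J SJ; apply: idealMl; apply: Sx. Qed.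

Definition gen_ideal S : ideal R :=
  Ideal (@gen_ideal0 S) (@gen_idealD S) (@gen_idealMl S).

Lemma ideal_exp I x m n : (m <= n)%N -> I (x ^+ m) -> I (x ^+ n).
Proof. by move=> /subnK <- Ixm; rewrite exprD; apply: idealMl. Qed.

Lemma ideal_sum I (s : seq nat) (F : nat -> R) :
  (forall i, I (F i)) -> I (\sum_(i <- s) F i).
Proof.
move=> IF; elim: s => [|i s IHs]; first by rewrite big_nil; apply: ideal0.
by rewrite big_cons; apply: idealD.
Qed.

Definition radical_set I : set R := fun x => exists n, I (x ^+ n).

Fact radical0 I : radical_set I 0.
Proof. by exists 1%N; rewrite expr1; apply: ideal0. Qed.

Fact radicalD I x y :
  radical_set I x -> radical_set I y -> radical_set I (x + y).
Proof.
move=> [m Ixm] [n Iyn]; exists (m + n)%N.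
rewrite exprDn -(big_mkord xpredT
  (fun i => (x ^+ (m + n - i) * y ^+ i) *+ 'C(m + n, i))).
apply: ideal_sum => i; rewrite -mulr_natl; apply: idealMl.
have [le_ni | lt_in] := leqP n i.
  by apply: idealMl; apply: ideal_exp Iyn.
rewrite mulrC; apply: idealMl; apply: ideal_exp Ixm.
by rewrite -addnBA ?leq_addr // ltnW.
Qed.

Fact radicalMl I a x : radical_set I x -> radical_set I (a * x).
Proof. by move=> [n Ixn]; exists n; rewrite exprMn; apply: idealMl. Qed.

Definition radical I : ideal R :=
  Ideal (@radical0 I) (@radicalD I) (@radicalMl I).

Definition noetherian : Prop :=
  forall I, exists n (f : 'I_n -> R), forall x, I x <-> gen_ideal (range f) x.

Definition generated_up_to_radical I r : Prop :=
  exists f : 'I_r -> R,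
    forall x, radical I x <-> radical (gen_ideal (range f)) x.

End Ideals.

Definition extended_ideal (R A : comPzRingType) (phi : {rmorphism R -> A})
  (I : ideal R) : ideal A := gen_ideal (phi @` ideal_set I).

Section QuotientRing.
Variables (A : comPzRingType) (I : ideal A).

Definition mem_ideal : A -> bool := fun x => `[< I x >].

Fact mem_ideal_zmod_closed : zmod_closed mem_ideal.
Proof.
split=> [|x y /asboolP Ix /asboolP Iy]; apply/asboolP; first exact: ideal0.
exact: idealB.
Qed.

HB.instance Definition _ :=
  GRing.isZmodClosed.Build A mem_ideal mem_ideal_zmod_closed.

Definition ideal_zmodClosed : zmodClosed A :=
  GRing.ZmodClosed.clone A mem_ideal _.

Definition quot : Type := Quotient.quot ideal_zmodClosed.

HB.instance Definition _ := GRing.Zmodule.on quot.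
HB.instance Definition _ := EqQuotient.on quot.

Definition proj (x : A) : quot := \pi_quot x.

Lemma projP x y : proj x = proj y <-> I (x - y).
Proof.
split=> [/eqP | Ixy].
  by rewrite -[_ == _](@Quotient.idealrBE A ideal_zmodClosed) => /asboolP.
apply/eqP; rewrite -[_ == _](@Quotient.idealrBE A ideal_zmodClosed).
exact/asboolP.
Qed.

Lemma reprK_proj (q : quot) : proj (repr q) = q.
Proof. exact: reprK. Qed.

Lemma projD x y : proj (x + y) = proj x + proj y.
Proof. by rewrite /proj [LHS](@Quotient.pi_add A ideal_zmodClosed). Qed.

Lemma proj0 : proj 0 = 0.
Proof. by apply: (addIr (proj 0)); rewrite -projD !add0r. Qed.

Definition quot_one : quot := proj 1.
Definition quot_mul (q q' : quot) : quot := proj (repr q * repr q').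

Lemma projM x y : proj (x * y) = quot_mul (proj x) (proj y).
Proof.
have rI z : I (z - repr (proj z)) by apply/projP; rewrite reprK_proj.
apply/projP; set x' := repr _; set y' := repr _.
have ->: x * y - x' * y' = y * (x - x') + x' * (y - y').
  by rewrite !mulrBr (mulrC y x) (mulrC y x') addrA subrK.
by apply: idealD; apply: idealMl; apply: rI.
Qed.

Fact quot_mulA : associative quot_mul.
Proof.
move=> q1 q2 q3; rewrite -(reprK_proj q1) -(reprK_proj q2) -(reprK_proj q3).
by rewrite -!projM mulrA.
Qed.

Fact quot_mulC : commutative quot_mul.
Proof.
by move=> q1 q2; rewrite -(reprK_proj q1) -(reprK_proj q2) -!projM mulrC.
Qed.

Fact quot_mul1 : left_id quot_one quot_mul.
Proof. by move=> q; rewrite -(reprK_proj q) -projM mul1r. Qed.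

Fact quot_mulDl : left_distributive quot_mul +%R.
Proof.
move=> q1 q2 q3; rewrite -(reprK_proj q1) -(reprK_proj q2) -(reprK_proj q3).
by rewrite -projD -!projM mulrDl projD.
Qed.

HB.instance Definition _ := GRing.Zmodule_isComPzRing.Build quot
  quot_mulA quot_mulC quot_mul1 quot_mulDl.

Definition quot_scale (a : A) (q : quot) : quot := proj a * q.

Fact quot_scaleA a b q : quot_scale a (quot_scale b q) = quot_scale (a * b) q.
Proof. by rewrite /quot_scale mulrA projM. Qed.

Fact quot_scale1 : left_id 1 quot_scale.
Proof. by move=> q; apply: quot_mul1. Qed.

Fact quot_scaleDr : right_distributive quot_scale +%R.
Proof. by move=> a q q'; rewrite /quot_scale mulrDr. Qed.

Fact quot_scaleDl q : {morph quot_scale^~ q : a b / a + b}.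
Proof. by move=> a b; rewrite /quot_scale projD mulrDl. Qed.

HB.instance Definition _ := GRing.Zmodule_isLmodule.Build A quot
  quot_scaleA quot_scale1 quot_scaleDr quot_scaleDl.

End QuotientRing.

Section RestrictScalars.
Variables (R A : comPzRingType) (phi : {rmorphism R -> A}) (M : lmodType A).

Definition restrict_scalars : Type := (fun=> GRing.Lmodule.sort M) phi.

HB.instance Definition _ := GRing.Zmodule.copy restrict_scalars M.

Definition restrict_scale (a : R) (v : restrict_scalars) : restrict_scalars :=
  phi a *: (v : M).

Fact restrict_scaleA a b v :
  restrict_scale a (restrict_scale b v) = restrict_scale (a * b) v.
Proof. by rewrite /restrict_scale scalerA rmorphM. Qed.

Fact restrict_scale1 : left_id 1 restrict_scale.
Proof. by move=> v; rewrite /restrict_scale rmorph1 scale1r. Qed.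

Fact restrict_scaleDr : right_distributive restrict_scale +%R.
Proof. by move=> a u v; apply: scalerDr. Qed.

Fact restrict_scaleDl v : {morph restrict_scale^~ v : a b / a + b}.
Proof. by move=> a b; rewrite /restrict_scale rmorphD; apply: scalerDl. Qed.

HB.instance Definition _ := GRing.Zmodule_isLmodule.Build R restrict_scalars
  restrict_scaleA restrict_scale1 restrict_scaleDr restrict_scaleDl.

End RestrictScalars.

Section HomologicalDimension.
Variable R : comPzRingType.

Definition projective (P : lmodType R) : Prop :=
  forall (M N : lmodType R) (g : {linear M -> N}) (f : {linear P -> N}),
    (forall y, exists x, g x = y) ->
    exists h : {linear P -> M}, forall x, g (h x) = f x.

Definition injective_module (E : lmodType R) : Prop :=
  forall (M N : lmodType R) (g : {linear M -> N}) (f : {linear M -> E}),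
    injective g ->
    exists h : {linear N -> E}, forall x, h (g x) = f x.

Definition zero_module (M : lmodType R) : Prop := forall x : M, x = 0.

Definition exact_seq (L M N : lmodType R) (f : L -> M) (g : M -> N) : Prop :=
  forall y, g y = 0 <-> exists x, f x = y.

(* pd(M) <= n: there is a projective resolution
   of M by P_0, P_1, etc. with P_i = 0 for i > n *)
Definition proj_dim_le (M : lmodType R) (n : nat) : Prop :=
  exists (P : nat -> lmodType R) (d : forall i, {linear P i.+1 -> P i})
         (e : {linear P 0%N -> M}),
    [/\ forall i, projective (P i),
        forall i, (n < i)%N -> zero_module (P i),
        forall y, exists x, e x = y,
        exact_seq (d 0%N) e
      & forall i, exact_seq (d i.+1) (d i)].

(* idim(M) <= n: there is an injective resolution
   of M by E_0, E_1, etc. with E_i = 0 for i > n *)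
Definition inj_dim_le (M : lmodType R) (n : nat) : Prop :=
  exists (E : nat -> lmodType R) (d : forall i, {linear E i -> E i.+1})
         (e : {linear M -> E 0%N}),
    [/\ forall i, injective_module (E i),
        forall i, (n < i)%N -> zero_module (E i),
        injective e,
        exact_seq e (d 0%N)
      & forall i, exact_seq (d i) (d i.+1)].

End HomologicalDimension.

Section Adic.
Variable A : comPzRingType.
Implicit Types (a b x : A) (u : nat -> A).

Definition divides a b : Prop := exists c, b = c * a.

Definition adic_cvg a u x : Prop :=
  forall n, exists N, forall m, (N <= m)%N -> divides (a ^+ n) (u m - x).

Definition adic_cauchy a u : Prop :=
  forall n, exists N, forall k m, (N <= k)%N -> (N <= m)%N ->
    divides (a ^+ n) (u k - u m).

Definition adic_separated a : Prop :=
  forall x, (forall n, divides (a ^+ n) x) -> x = 0.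

Definition adic_complete a : Prop :=
  adic_separated a /\ forall u, adic_cauchy a u -> exists x, adic_cvg a u x.

(* Only meaningful when A is a-adically separated and the sequence converges. *)
Definition adic_lim a u : A := xget 0 [set x | adic_cvg a u x].

End Adic.

(* A p-typical Witt vector over [B] is its sequence of Witt components. The
   product is given by the universal polynomials P_n over int, in the variables
   X_0, X_1, etc. and Y_0, Y_1, etc. (indexed by nat + nat), such that
   w_n(P) = w_n(X) * w_n(Y) for all n, where
   w_n(Z) = \sum_(i <= n) p^i Z_i^(p^(n-i)) is the n-th ghost component. *)

Section WittPolynomials.
Variable p : nat.

Local Notation witt_poly := {malg int[{cmonom (nat + nat)%type}]}.

Definition witt_var (i : nat + nat) : witt_poly :=
  << 1 *g ucm i >>.

Definition witt_poly_div (P : witt_poly) (d : int) : witt_poly :=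
  \sum_(m <- msupp P) << (P@_m %/ d)%Z *g m >>.

Definition witt_poly_eval (B : comPzRingType) (v : nat + nat -> B)
  (P : witt_poly) : B :=
  \sum_(m <- msupp P)
    (\prod_(i <- finsupp m) v i ^+ m i) *~ P@_m.

Definition ghost (B : comPzRingType) (x : nat -> B) (n : nat) : B :=
  \sum_(i < n.+1) p%:R ^+ i * x i ^+ (p ^ (n - i)).

Definition ghost_mul (n : nat) : witt_poly :=
  ghost (fun i => witt_var (inl i)) n * ghost (fun i => witt_var (inr i)) n.

(* The sequence of the P_i for i < n, obtained by solving the ghost equations
   recursively: p^n P_n = w_n(X) * w_n(Y) - \sum_(i < n) p^i P_i^(p^(n-i)).
   For p prime, the coefficientwise division by p^n is exact. *)
Fixpoint witt_mul_polys (n : nat) : seq witt_poly :=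
  if n is n'.+1 then
    let s := witt_mul_polys n' in
    rcons s (witt_poly_div
      (ghost_mul n' - \sum_(i < n') p%:R ^+ i * s`_i ^+ (p ^ (n' - i)))
      (p%:Z ^+ n'))
  else [::].

Definition witt_mul_poly (n : nat) : witt_poly := (witt_mul_polys n.+1)`_n.

End WittPolynomials.

Definition witt (B : Type) : Type := nat -> B.

Definition witt_mul (p : nat) (B : comPzRingType) (x y : witt B) : witt B :=
  fun n => witt_poly_eval
    (fun i => match i with inl j => x j | inr j => y j end)
    (witt_mul_poly p n).

Section Tilt.
Variables (p : nat) (p_prime : prime p) (A : comPzRingType).

Definition modp : comPzRingType := quot (gen_ideal [set (p%:R : A)]).

Fact modp_p : p%:R = 0 :> modp.
Proof.
have projn n : proj (gen_ideal [set (p%:R : A)]) n%:R = n%:R.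
  by elim: n => [|n IHn]; rewrite ?mulr0n ?proj0 // !mulrS projD IHn.
by rewrite -projn -proj0; apply/projP; rewrite subr0 => J; apply.
Qed.

Fact modp_FrobeniusD (x y : modp) : (x + y) ^+ p = x ^+ p + y ^+ p.
Proof.
have p_gt0 := prime_gt0 p_prime.
rewrite exprDn -(prednK p_gt0) big_ord_recl big_ord_recr /= prednK //.
rewrite subn0 expr0 mulr1 bin0 mulr1n /bump /= add1n prednK // subnn mul1r.
rewrite binn mulr1n big1 ?add0r // => i _.
have /dvdnP[k ->] : (p %| 'C(p, bump 0 i))%N.
  by apply: prime_dvd_bin => //; rewrite /bump /= add1n -ltn_predRL ltn_ord.
by rewrite mulrnA -[LHS]mulr_natr [X in _ * X]modp_p mulr0.
Qed.

Fact modp_FrobeniusB (x y : modp) : (x - y) ^+ p = x ^+ p - y ^+ p.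
Proof. by apply: (addIr (y ^+ p)); rewrite -modp_FrobeniusD !subrK. Qed.

Definition is_tilt : {pred (nat -> modp)} :=
  fun x => `[< forall n, x n.+1 ^+ p = x n >].

Fact is_tilt_subring_closed : subring_closed is_tilt.
Proof.
split=> [|x y /asboolP tx /asboolP ty|x y /asboolP tx /asboolP ty];
  apply/asboolP => n.
- exact: expr1n.
- by rewrite -[RHS]/(x n - y n) -tx -ty; apply: modp_FrobeniusB.
- by rewrite -[RHS]/(x n * y n) -tx -ty; apply: exprMn.
Qed.

(* A^flat, the inverse limit of A/pA along x |-> x^p *)
Record tilt : Type := Tilt {
  tilt_seq : nat -> modp;
  tilt_seqP : is_tilt tilt_seq
}.

HB.instance Definition _ := [isSub for tilt_seq].
HB.instance Definition _ := [Choice of tilt by <:].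
HB.instance Definition _ := GRing.SubChoice_isSubComPzRing.Build
  (nat -> modp) is_tilt tilt is_tilt_subring_closed.

Fact tilt_root_subproof (i : nat) (x : tilt) :
  is_tilt (fun k => tilt_seq x (i + k)).
Proof.
apply/asboolP => k; rewrite addnS.
by have /asboolP := tilt_seqP x; apply.
Qed.

(* x^(1/p^i), obtained by shifting the sequence *)
Definition tilt_root (i : nat) (x : tilt) : tilt :=
  Tilt (tilt_root_subproof i x).

(* x^sharp = lim_k y_k^(p^k), where y_k in A lifts the k-th component of x *)
Definition sharp (x : tilt) : A :=
  adic_lim p%:R (fun k => repr (tilt_seq x k) ^+ (p ^ k)).

(* Fontaine's map on W(A^flat): the Witt vector with components x_i is
   \sum_i p^i [x_i^(1/p^i)], and theta maps it to
   \sum_i p^i (x_i^(1/p^i))^sharp. *)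
Definition theta (x : witt tilt) : A :=
  adic_lim p%:R (fun n => \sum_(i < n) p%:R ^+ i * sharp (tilt_root i (x i))).

Definition perfectoid : Prop :=
  [/\ exists pi : A, divides (pi ^+ p) p%:R /\ adic_complete pi,
      forall x : modp, exists y : modp, y ^+ p = x
    & exists xi : witt tilt, forall x : witt tilt,
        theta x = 0 <-> exists w : witt tilt, x = witt_mul p xi w].

End Tilt.

(* Main.v *)
(* Let J_0 be the radical of pA and J_(k+1) the radical of J_k + f_(k+1) A, so
   that J_r is the radical of IA. Each passage from M = A (resp. A/J_k) to
   M' = A/J_0 (resp. A/J_(k+1)) kills an increasing union N of submodules g_n M,
   where the g_n are compatible p-power roots of a suitable associate of p in A,
   resp. of f_(k+1) in the perfect ring A/J_k. As g_n and g_(n+1)^(p-1) have the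
   same annihilator in M, N is the colimit of M -> M -> ... along multiplication
   by g_(n+1)^(p-1), and there are exact sequences
     0 -> M^(oo) -> M^(oo) -> N -> 0   and   0 -> N -> M -> M' -> 0.
   They raise the projective dimension by at most 2, and do not raise the
   injective dimension over R, because direct sums of injective modules over a
   Noetherian ring are injective.
   For p itself, the roots come from a generator xi of ker theta: xi_0^sharp is
   an associate of p because xi_1 is a unit. That g_n x = 0 implies
   g_(n+1) x = 0 is read off the components of Witt vectors xi w. *)
From HB Require Import structures.
Require Import Defs.
From mathcomp Require Import all_boot all_order all_algebra.
From mathcomp Require Import finmap.
From mathcomp Require Import boolp classical_sets functions.
From mathcomp Require Import monalg.
From mathcomp Require Import ring.

Set Implicit Arguments.
Unset Strict Implicit.
Unset Printing Implicit Defensive.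
Import GRing.Theory.

Local Open Scope ring_scope.

(** * Linear maps, submodules and quotients *)

(** The bound 2(r+1) counts r+1 passages, one for p and one for each generator, at two short exact
    sequences each. The obstacle is torsion. Multiplication by g_n need not be injective on M, and
    the union of the g_n M is the wanted colimit only if g_n x = 0 forces g_(n+1) x = 0. In A/J_k
    this is reducedness. In A itself the question is moved to A^flat, which is perfect and reduced:
    a relation 0 = \sum_i p^i (c_i)^sharp in A makes the c_i^(p^i) the components of some product xi
    w, and the few components that matter can be computed modulo suitable variables. That xi_1 is a
    unit comes from the element pi: writing p as a multiple of pi^p produces an explicit element of
    ker theta whose component 1 is invertible modulo p, and as this element is a multiple of xi, the
    same holds for xi_1. *)

Section LinearMaps.
Variable R : comPzRingType.
Implicit Types L M N X Y Z : lmodType R.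

Definition mklin M N (f : M -> N) (fP : linear f) : {linear M -> N} :=
  HB.pack f (GRing.isLinear.Build R M N *:%R f fP).

Lemma ex_lift X Y M (i : {linear X -> Y}) (f : {linear M -> Y}) :
  injective i -> (forall m, exists x, i x = f m) ->
  exists h : {linear M -> X}, forall m, i (h m) = f m.
Proof.
move=> inj_i /choice[h hP].
have hL : linear h by move=> a u v; apply: inj_i; rewrite linearP !hP linearP.
by exists (mklin hL).
Qed.

Lemma ex_desc Y Z M (q : {linear Y -> Z}) (f : {linear Y -> M}) :
  (forall z, exists y, q y = z) -> (forall y, q y = 0 -> f y = 0) ->
  exists h : {linear Z -> M}, forall y, h (q y) = f y.
Proof.
move=> /choice[s sP] qf.
have fs y : f (s (q y)) = f y.
  by apply/eqP; rewrite -subr_eq0 -linearB; apply/eqP/qf;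
    rewrite linearB sP subrr.
have hL : linear (f \o s).
  move=> a u v /=; rewrite -linearP -[RHS]fs; congr (f (s _)).
  by rewrite linearP !sP.
by exists (mklin hL) => y; apply: fs.
Qed.

Definition ses X Y Z (i : {linear X -> Y}) (q : {linear Y -> Z}) : Prop :=
  [/\ injective i, exact_seq i q & forall z, exists y, q y = z].

Lemma lin_inj X Y (f : {linear X -> Y}) :
  (forall x, f x = 0 -> x = 0) -> injective f.
Proof.
by move=> f0 x y /eqP; rewrite -subr_eq0 -linearB => /eqP/f0/eqP;
  rewrite subr_eq0 => /eqP.
Qed.

End LinearMaps.

Section Submodule.
Variables (R : comPzRingType) (M : lmodType R).

Record submodule := Submodule {
  submodule_set :> M -> Prop;
  submodule0 : submodule_set 0;
  submoduleP : forall a x y,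
    submodule_set x -> submodule_set y -> submodule_set (a *: x + y)
}.

Variable S : submodule.

Definition in_submodule : {pred M} := fun x => `[< S x >].

Fact in_submodule_closed : submod_closed in_submodule.
Proof.
split=> [|a x y /asboolP Sx /asboolP Sy]; apply/asboolP;
  first exact: submodule0.
exact: submoduleP.
Qed.

HB.instance Definition _ :=
  GRing.isSubmodClosed.Build R M in_submodule in_submodule_closed.

Record submod_type := SubmodType {
  submod_val : M;
  submod_valP : submod_val \in in_submodule
}.

HB.instance Definition _ := [isSub for submod_val].
HB.instance Definition _ := [Choice of submod_type by <:].
HB.instance Definition _ :=
  GRing.SubChoice_isSubLmodule.Build R M in_submodule submod_type
    in_submodule_closed.

Fact submod_val_linear : linear submod_val.
Proof. by move=> a x y; rewrite -[submod_val _]/(val _) linearP. Qed.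

Definition submod_incl : {linear submod_type -> M} := mklin submod_val_linear.

Lemma submod_incl_inj : injective submod_incl.
Proof. exact: val_inj. Qed.

Lemma submod_inclP x : S x <-> exists y, submod_incl y = x.
Proof.
split=> [/asboolP Sx|[[y /asboolP Sy] <-//]].
by exists (SubmodType Sx).
Qed.

Definition quot_mod : Type := Quotient.quot (GRing.ZmodClosed.clone M
  in_submodule _).

HB.instance Definition _ := GRing.Zmodule.on quot_mod.
HB.instance Definition _ := EqQuotient.on quot_mod.

Definition quot_mod_pi (x : M) : quot_mod := \pi_quot_mod%qT x.

Lemma quot_mod_piP x y : quot_mod_pi x = quot_mod_pi y <-> S (x - y).
Proof.
pose SM := GRing.ZmodClosed.clone M in_submodule _.
split=> [/eqP | Sxy].
  by rewrite -[_ == _](@Quotient.idealrBE M SM) => /asboolP.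
apply/eqP; rewrite -[_ == _](@Quotient.idealrBE M SM).
exact/asboolP.
Qed.

Lemma quot_mod_pi_repr (q : quot_mod) : quot_mod_pi (repr q) = q.
Proof. exact: reprK. Qed.

Lemma quot_mod_piD x y : quot_mod_pi (x + y) = quot_mod_pi x + quot_mod_pi y.
Proof.
by rewrite /quot_mod_pi [LHS](@Quotient.pi_add M (GRing.ZmodClosed.clone M
  in_submodule _)).
Qed.

Definition quot_mod_scale a (q : quot_mod) : quot_mod := quot_mod_pi (a *: repr
  q).

Lemma quot_mod_piZ a x : quot_mod_pi (a *: x) = quot_mod_scale a (quot_mod_pi
  x).
Proof.
apply/quot_mod_piP; rewrite -scalerBr -[_ *: _]addr0.
apply: submoduleP; last exact: submodule0.
by apply/quot_mod_piP; rewrite quot_mod_pi_repr.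
Qed.

Fact quot_mod_scaleA a b q :
  quot_mod_scale a (quot_mod_scale b q) = quot_mod_scale (a * b) q.
Proof. by rewrite -(quot_mod_pi_repr q) -!quot_mod_piZ scalerA. Qed.

Fact quot_mod_scale1 : left_id 1 quot_mod_scale.
Proof. by move=> q; rewrite -(quot_mod_pi_repr q) -!quot_mod_piZ scale1r. Qed.

Fact quot_mod_scaleDr : right_distributive quot_mod_scale +%R.
Proof.
move=> a q r; rewrite -(quot_mod_pi_repr q) -(quot_mod_pi_repr r).
by rewrite -quot_mod_piD -!quot_mod_piZ -quot_mod_piD scalerDr.
Qed.

Fact quot_mod_scaleDl q : {morph quot_mod_scale^~ q : a b / a + b}.
Proof.
by move=> a b;
  rewrite -(quot_mod_pi_repr q) -!quot_mod_piZ -quot_mod_piD scalerDl.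
Qed.

HB.instance Definition _ := GRing.Zmodule_isLmodule.Build R quot_mod
  quot_mod_scaleA quot_mod_scale1 quot_mod_scaleDr quot_mod_scaleDl.

Fact quot_mod_pi_linear : linear quot_mod_pi.
Proof. by move=> a x y; rewrite quot_mod_piD quot_mod_piZ. Qed.

Definition quot_mod_proj : {linear M -> quot_mod} := mklin quot_mod_pi_linear.

Lemma quot_mod_proj_surj z : exists y, quot_mod_proj y = z.
Proof. by exists (repr z); apply: quot_mod_pi_repr. Qed.

Lemma quot_mod_proj_eq0 x : quot_mod_proj x = 0 <-> S x.
Proof.
rewrite -[X in S X]subr0 -quot_mod_piP.
by rewrite -[quot_mod_pi 0]/(quot_mod_proj 0) linear0.
Qed.

End Submodule.

Section KernelImage.
Variables (R : comPzRingType) (M N : lmodType R) (f : {linear M -> N}).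

Fact ker_subproof0 : f 0 = 0. Proof. exact: linear0. Qed.

Fact ker_subproofP a x y : f x = 0 -> f y = 0 -> f (a *: x + y) = 0.
Proof. by move=> fx fy; rewrite linearP fx fy scaler0 addr0. Qed.

Definition ker_submodule : submodule M := Submodule ker_subproof0 ker_subproofP.

Definition ker_mod : lmodType R := submod_type ker_submodule.

Definition ker_incl : {linear ker_mod -> M} := locked (submod_incl
  ker_submodule).

Lemma ker_incl_inj : injective ker_incl. Proof. rewrite /ker_incl -lock;
  exact: submod_incl_inj. Qed.

Lemma exact_ker : exact_seq ker_incl f.
Proof.
by move=> y; rewrite /ker_incl -lock; apply: (submod_inclP ker_submodule).
Qed.

Lemma ses_ker : (forall z, exists y, f y = z) -> ses ker_incl f.
Proof. by split; [apply: ker_incl_inj | apply: exact_ker |]. Qed.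

Fact im_subproof0 : exists x, f x = 0. Proof. by exists 0; apply: linear0. Qed.

Fact im_subproofP a y z :
  (exists x, f x = y) -> (exists x, f x = z) -> exists x, f x = a *: y + z.
Proof. by move=> [x <-] [x' <-]; exists (a *: x + x'); rewrite linearP. Qed.

Definition im_submodule : submodule N := Submodule im_subproof0 im_subproofP.

Definition coker_mod : lmodType R := quot_mod im_submodule.

Definition coker_proj : {linear N -> coker_mod} :=
  locked (quot_mod_proj im_submodule).

Lemma coker_proj_surj z : exists y, coker_proj y = z.
Proof. rewrite /coker_proj -lock; exact: quot_mod_proj_surj. Qed.

Lemma exact_coker : exact_seq f coker_proj.
Proof.
by move=> y; rewrite /coker_proj -lock; apply: (quot_mod_proj_eq0 im_submodule).
Qed.

Lemma ses_coker : injective f -> ses f coker_proj.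
Proof. by split; [| apply: exact_coker | apply: coker_proj_surj]. Qed.

End KernelImage.

Arguments ker_incl : simpl never.
Arguments coker_proj : simpl never.

Section ShortExact.
Variables (R : comPzRingType) (X Y Z : lmodType R).
Variables (i : {linear X -> Y}) (q : {linear Y -> Z}).
Hypothesis iq : ses i q.

Lemma ses_comp0 x : q (i x) = 0.
Proof. by case: iq => _ ex _; apply/ex; exists x. Qed.

Lemma ses_sub y y' : q y = q y' -> exists x, y = y' + i x.
Proof.
move=> /eqP; rewrite -subr_eq0 -linearB => /eqP qy.
case: iq => _ ex _; have [x xP] := (ex _).1 qy.
by exists x; rewrite xP addrC subrK.
Qed.

Lemma ses_retraction (s : {linear Z -> Y}) : (forall z, q (s z) = z) ->
  exists r : {linear Y -> X}, forall y, y = i (r y) + s (q y).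
Proof.
move=> qs; have [inj_i ex surj] := iq.
have fL : linear (fun y => y - s (q y)).
  by move=> a x y; rewrite !linearP addrACA -scalerDr.
have [|r rP] := @ex_lift R X Y Y i (mklin fL) inj_i.
  by move=> y; apply/ex; rewrite /= linearB qs subrr.
by exists r => y; rewrite rP /= subrK.
Qed.

Lemma ses_section (r : {linear Y -> X}) : (forall x, r (i x) = x) ->
  exists s : {linear Z -> Y}, forall y, y = i (r y) + s (q y).
Proof.
move=> ri; have [inj_i ex surj] := iq.
have fL : linear (fun y => y - i (r y)).
  by move=> a x y; rewrite !linearP addrACA -scalerDr.
have [|s sP] := @ex_desc R Y Z Y q (mklin fL) surj.
  by move=> y /ex[x <-] /=; rewrite ri subrr.
by exists s => y; rewrite sP /= addrC subrK.
Qed.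

End ShortExact.

Section Operations.
Variable R : comPzRingType.
Implicit Types L M N X Y Z : lmodType R.

Definition compl L M N (g : {linear M -> N}) (f : {linear L -> M}) : {linear L
  -> N} :=
  g \o f.

Fact idl_linear M : linear (@id M). Proof. by []. Qed.
Definition idl M : {linear M -> M} := mklin (@idl_linear M).

Fact fstl_linear M N : linear (@fst M N). Proof. by []. Qed.
Definition fstl M N : {linear (M * N)%type -> M} := mklin (@fstl_linear M N).
Fact sndl_linear M N : linear (@snd M N). Proof. by []. Qed.
Definition sndl M N : {linear (M * N)%type -> N} := mklin (@sndl_linear M N).

Fact pairl_linear L M N (f : {linear L -> M}) (g : {linear L -> N}) :
  linear (fun x => (f x, g x)).
Proof. by move=> a x y; rewrite !linearP. Qed.
Definition pairl L M N (f : {linear L -> M}) (g : {linear L -> N}) :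
  {linear L -> (M * N)%type} := mklin (pairl_linear f g).

Fact copairl_linear L M N (f : {linear M -> L}) (g : {linear N -> L}) :
  linear (fun x : (M * N)%type => f x.1 + g x.2).
Proof. by move=> a x y; rewrite /= !linearP scalerDr addrACA. Qed.
Definition copairl L M N (f : {linear M -> L}) (g : {linear N -> L}) :
  {linear (M * N)%type -> L} := mklin (copairl_linear f g).

Fact zerol_linear M N : linear (fun _ : M => 0 : N).
Proof. by move=> a x y; rewrite scaler0 addr0. Qed.
Definition zerol M N : {linear M -> N} := mklin (@zerol_linear M N).

Fact subl_linear M N (f g : {linear M -> N}) : linear (fun x => f x - g x).
Proof. by move=> a x y; rewrite !linearP addrACA -scalerDr. Qed.
Definition subl M N (f g : {linear M -> N}) : {linear M -> N} :=
  mklin (subl_linear f g).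

Definition zero_mod : lmodType R := 'M[R]_(0, 0).

Lemma zero_modP : zero_module zero_mod.
Proof. by move=> x; apply/matrixP; case. Qed.

End Operations.

(** * Projective dimension *)

Section ProjectiveDimension.
Variable R : comPzRingType.
Implicit Types K L M N P X Y Z : lmodType R.

Lemma projective_zero M : zero_module M -> projective M.
Proof.
move=> M0 L N g f _; exists (zerol M L) => x.
by rewrite (M0 x) !linear0.
Qed.

Lemma projective_prod M N : projective M -> projective N ->
  projective (M * N)%type.
Proof.
move=> pM pN L L' g f surj.
have [h hP] := pM _ _ g (compl f (pairl (idl M) (zerol M N))) surj.
have [k kP] := pN _ _ g (compl f (pairl (zerol N M) (idl N))) surj.
exists (copairl h k) => x; rewrite linearD hP kP /= -linearD.
by congr (f _); case: x => a b; congr (_, _) => /=; rewrite ?addr0 ?add0r.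
Qed.

Lemma projective_section M P (q : {linear M -> P}) :
  projective P -> (forall z, exists y, q y = z) ->
  exists s : {linear P -> M}, forall z, q (s z) = z.
Proof. by move=> pP; apply: (pP _ _ q (idl P)). Qed.

Lemma projective_ext X Y Z (i : {linear X -> Y}) (q : {linear Y -> Z}) :
  ses i q -> projective X -> projective Z -> projective Y.
Proof.
move=> iq pX pZ; have [_ _ surj] := iq.
have [s sP] := projective_section pZ surj.
have [r rP] := ses_retraction iq sP.
move=> L N g f gS.
have [h hP] := pX _ _ g (compl f i) gS.
have [k kP] := pZ _ _ g (compl f s) gS.
exists (compl (copairl h k) (pairl r q)) => y.
by rewrite /= linearD hP kP /= -linearD -rP.
Qed.

(** A resolution of length n, peeled off one syzygy at a time, so that dimension estimates become
    inductions on short exact sequences. *)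
Fixpoint pd_at_most n M : Prop :=
  if n is n'.+1 then
    exists (K P : lmodType R) (i : {linear K -> P}) (q : {linear P -> M}),
      [/\ projective P, ses i q & pd_at_most n' K]
  else projective M.

Lemma pd_at_most_S n M : pd_at_most n M -> pd_at_most n.+1 M.
Proof.
elim: n M => [|n IHn] M.
  move=> pM; exists (ker_mod (idl M)), M, (ker_incl _), (idl M); split=> //.
    by apply: ses_ker => z; exists z.
  by apply: projective_zero => -[x x0]; apply: val_inj; apply: (asboolW x0).
by move=> [K [P [i [q [pP iq PDK]]]]]; exists K, P, i, q; split=> //;
  apply: IHn.
Qed.

(** Horseshoe lemma: [PX * PZ] covers Y, and the kernels of the three covers again form a short
    exact sequence. *)
Lemma pd_at_most_ext n X Y Z (i : {linear X -> Y}) (q : {linear Y -> Z}) :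
  ses i q -> pd_at_most n X -> pd_at_most n Z -> pd_at_most n Y.
Proof.
elim: n X Y Z i q => [|n IHn] X Y Z i q iq; first exact: projective_ext iq.
move=> [KX [PX [iX [qX [pPX sX PDX]]]]] [KZ [PZ [iZ [qZ [pPZ sZ PDZ]]]]].
have [inj_i ex surj] := iq.
have [inj_iX exX surjX] := sX; have [inj_iZ exZ surjZ] := sZ.
have [l lP] := pPZ _ _ q qZ surj.
pose e := copairl (compl i qX) l.
have eS z : exists y, e y = z.
  have [c cP] := surjZ (q z).
  have [|x zE] := ses_sub iq (y := z) (y' := l c); first by rewrite lP.
  by have [a aP] := surjX x; exists (a, c); rewrite /= aP addrC.
have [|u uP] := @ex_lift R _ _ KX (ker_incl e) (pairl iX (zerol KX PZ))
  (@ker_incl_inj _ _ _ _).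
  by move=> x; apply/exact_ker; rewrite /= (ses_comp0 sX) !linear0 addr0.
have [|v vP] := @ex_lift R _ _ (ker_mod e) iZ (compl (sndl PX PZ) (ker_incl e))
  inj_iZ.
  move=> x; apply/exZ => /=.
  have /(congr1 q) := (exact_ker e (ker_incl e x)).2 (ex_intro _ x erefl).
  by rewrite /= linearD linear0 (ses_comp0 iq) add0r lP.
exists (ker_mod e), (PX * PZ)%type, (ker_incl e), e; split.
- exact: projective_prod.
- exact: ses_ker.
- apply: (IHn KX _ KZ u v) => //; split.
  + by move=> x y /(congr1 (ker_incl e)); rewrite !uP => -[/inj_iX].
  + move=> y; split=> [vy|[x <-]]; last first.
      by apply: inj_iZ; rewrite vP linear0 /= uP.
    have y2 : (ker_incl e y).2 = 0 by rewrite -[LHS]vP vy linear0.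
    have ey : e (ker_incl e y) = 0 by apply/exact_ker; exists y.
    have /exX[x xP] : qX (ker_incl e y).1 = 0.
      by apply: inj_i; rewrite linear0 -[RHS]ey /= y2 linear0 addr0.
    exists x; apply: (@ker_incl_inj _ _ _ e); rewrite uP /= xP.
    by move: y2; case: (ker_incl e y) => ? ? /= ->.
  (* The lift [l (iZ z)] need not vanish but comes from X; a preimage in [PX] of the opposite
     element corrects it. *)
  + move=> z.
    have /ex[x xP] : q (l (iZ z)) = 0 by rewrite lP (ses_comp0 sZ).
    have [a aP] := surjX (- x).
    have /exact_ker[y yP] : e (a, iZ z) = 0.
      by rewrite /= aP linearN xP addNr.
    by exists y; apply: inj_iZ; rewrite vP /= yP.
Qed.

(** A projective cover P of Y with kernel K also covers Z, and there its kernel is an extension of X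
    by K. *)
Lemma pd_at_most_coker n X Y Z (i : {linear X -> Y}) (q : {linear Y -> Z}) :
  ses i q -> pd_at_most n X -> pd_at_most n.+1 Y -> pd_at_most n.+1 Z.
Proof.
move=> iq PDX [K [P [iK [qK [pP sK PDK]]]]].
have [inj_i ex surj] := iq; have [inj_iK exK surjK] := sK.
pose e := compl q qK.
have [|u uP] := @ex_lift R _ _ K (ker_incl e) iK (@ker_incl_inj _ _ _ _).
  by move=> x; apply/exact_ker; rewrite /= (ses_comp0 sK) !linear0.
have [|v vP] := @ex_lift R _ _ (ker_mod e) i (compl qK (ker_incl e)) inj_i.
  by move=> x; apply/ex/(exact_ker e); exists x.
exists (ker_mod e), P, (ker_incl e), e; split=> //.
  apply: ses_ker => z; have [y <-] := surj z; have [x <-] := surjK y.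
  by exists x.
apply: (pd_at_most_ext (i := u) (q := v)) PDK PDX; split.
- by move=> x y /(congr1 (ker_incl e)); rewrite !uP => /inj_iK.
- move=> y; split=> [vy|[x <-]]; last first.
    by apply: inj_i; rewrite vP /= uP linear0 (ses_comp0 sK).
  have /exK[x xP] : qK (ker_incl e y) = 0 by rewrite -[LHS]vP vy linear0.
  by exists x; apply: (@ker_incl_inj _ _ _ e); rewrite uP.
- move=> x; have [y yP] := surjK (i x).
  have /exact_ker[y' y'P] : e y = 0 by rewrite /= yP (ses_comp0 iq).
  by exists y'; apply: inj_i; rewrite vP /= y'P.
Qed.

Lemma pd_at_most_proj_dim_le n M : pd_at_most n M -> proj_dim_le M n.
Proof.
elim: n M => [|n IHn] M.
  move=> pM.
  pose P k : lmodType R := if k is 0 then M else zero_mod R.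
  pose d k : {linear P k.+1 -> P k} := zerol _ _.
  exists P, d, (idl M : {linear P 0%N -> M}); split=> //.
  - by case=> // k; apply/projective_zero/zero_modP.
  - by case=> // k _; apply: zero_modP.
  - by move=> y; exists y.
  - by move=> y; split=> [/= ->|[x <-] //]; exists 0.
  - by move=> k y; split=> [_|[x <-]//]; exists 0;
      rewrite linear0 (zero_modP y).
move=> [K [P0 [i [q [pP [inj_i ex surj] /IHn[P [d [e [pP' P'0 eS de dd]]]]]]]]].
pose P' k : lmodType R := if k is k'.+1 then P k' else P0.
pose d' k : {linear P' k.+1 -> P' k} :=
  match k with 0 => compl i e | k'.+1 => d k' end.
exists P', d', (q : {linear P' 0%N -> M}); split=> //.
- by case.
- by case=> // k; apply: P'0.
- move=> y; split=> [/ex[x <-]|[x <-]]; last by apply/ex; exists (e x).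
  by have [z <-] := eS x; exists z.
- case=> [|k] y; last exact: dd.
  rewrite /d' /= -de; split=> [iy|->]; last exact: linear0.
  by apply: inj_i; rewrite iy linear0.
Qed.

End ProjectiveDimension.

(** * Countable direct sums and telescopes *)

Section DirectSum.
Variables (R : comPzRingType) (M : lmodType R).

Definition fin_supp (N : nat) (x : nat -> M) : Prop :=
  forall i, (N <= i)%N -> x i = 0.

Fact fin_supp0 : exists N, fin_supp N 0. Proof. by exists 0%N. Qed.

Fact fin_suppP a x y : (exists N, fin_supp N x) -> (exists N, fin_supp N y) ->
  exists N, fin_supp N (a *: x + y).
Proof.
move=> [N xN] [K yK]; exists (maxn N K) => i; rewrite geq_max => /andP[Ni Ki].
by rewrite -[LHS]/(a *: x i + y i) xN // yK // scaler0 addr0.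
Qed.

Definition fin_supp_submodule : submodule (nat -> M) :=
  Submodule fin_supp0 fin_suppP.

Definition dsum : lmodType R := submod_type fin_supp_submodule.

Definition dval : {linear dsum -> (nat -> M)} :=
  locked (submod_incl fin_supp_submodule).

Lemma dval_inj : injective dval.
Proof. rewrite /dval -lock; exact: submod_incl_inj. Qed.

Lemma dsumP x : (exists N, fin_supp N x) <-> exists y, dval y = x.
Proof. by rewrite /dval -lock; apply: (submod_inclP fin_supp_submodule). Qed.

Lemma dval_supp x : exists N, fin_supp N (dval x).
Proof. by apply/dsumP; exists x. Qed.

Lemma dvalP a x y i : dval (a *: x + y) i = a *: dval x i + dval y i.
Proof. by rewrite linearP. Qed.

Lemma dval_ext x y : (forall i, dval x i = dval y i) -> x = y.
Proof. by move=> xy; apply/dval_inj/funext. Qed.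

Lemma dval0 i : dval 0 i = 0.
Proof. by rewrite linear0. Qed.

(** Universal property of the direct sum. Every bound N of the support is allowed, so that each use
    can take the most convenient one. *)
Lemma dsum_fold (L : lmodType R) (h : nat -> {linear M -> L}) :
  exists s : {linear dsum -> L}, forall x N, fin_supp N (dval x) ->
    s x = \sum_(i < N) h i (dval x i).
Proof.
have [b bP] := choice dval_supp.
pose f x := \sum_(i < b x) h i (dval x i).
have widen (x : dsum) K N : fin_supp K (dval x) -> (K <= N)%N ->
    \sum_(i < N) h i (dval x i) = \sum_(i < K) h i (dval x i).
  move=> xK KN; rewrite -!(big_mkord xpredT (fun i => h i (dval x i))).
  rewrite (big_cat_nat (n := K)) //= [X in _ + X]big_nat_cond [X in _ + X]big1
    ?addr0 // => i.
  by rewrite andbT => /andP[Ki _]; rewrite xK ?linear0.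
have fE x N : fin_supp N (dval x) -> f x = \sum_(i < N) h i (dval x i).
  by move=> xN; case: (leqP N (b x)) => [|/ltnW];
    [apply: widen | move/(widen _ _ _ (bP x))].
have fL : linear f.
  move=> a x y; pose N := maxn (b (a *: x + y)) (maxn (b x) (b y)).
  have [Nxy Nx Ny] : [/\ (b (a *: x + y)%R <= N)%N, (b x <= N)%N & (b y <=
    N)%N].
    by rewrite /N !leq_max !leqnn /= !orbT.
  have bN z : (b z <= N)%N -> fin_supp N (dval z).
    by move=> zN i Ni; apply: bP; apply: leq_trans Ni.
  rewrite (fE _ _ (bN _ Nx)) (fE _ _ (bN _ Ny)) (fE _ _ (bN _ Nxy)) scaler_sumr
    -big_split; apply: eq_bigr => i _ /=.
  by rewrite dvalP linearP.
by exists (mklin fL).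
Qed.

Fact dsum_inj_subproof n (m : M) :
  exists y, dval y = fun i => if i == n then m else 0.
Proof. by apply/dsumP; exists n.+1 => i ni; rewrite gtn_eqF. Qed.

Lemma dsum_in n : exists j : {linear M -> dsum},
  forall m i, dval (j m) i = if i == n then m else 0.
Proof.
have [f fP] := choice (dsum_inj_subproof n).
have fL : linear f.
  move=> a x y; apply: dval_ext => i; rewrite dvalP !fP.
  by case: eqP => // _; rewrite scaler0 addr0.
by exists (mklin fL) => m i /=; rewrite fP.
Qed.

End DirectSum.

Arguments dval {R M}.

Section DirectSumMap.
Variable R : comPzRingType.
Implicit Types K L M N P X Y Z : lmodType R.

Lemma dsum_map M N (f : {linear M -> N}) :
  exists g : {linear dsum M -> dsum N}, forall x i, dval (g x) i = f (dval x i).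
Proof.
have fP (x : dsum M) : exists y : dsum N, dval y = f \o dval x.
  have [K xK] := dval_supp x; apply/dsumP; exists K => i Ki /=.
  by rewrite xK // linear0.
have [g gP] := choice fP.
have gL : linear g.
  by move=> a x y; apply: dval_ext => i; rewrite dvalP !gP /= dvalP linearP.
by exists (mklin gL) => x i; rewrite /= gP.
Qed.

Lemma ses_dsum X Y Z (i : {linear X -> Y}) (q : {linear Y -> Z}) : ses i q ->
  exists (i' : {linear dsum X -> dsum Y}) (q' : {linear dsum Y -> dsum Z}), ses
    i' q'.
Proof.
move=> [inj_i ex surj].
have [i' i'P] := dsum_map i; have [q' q'P] := dsum_map q.
exists i', q'; split.
- by move=> x y ixy; apply: dval_ext => n; apply: inj_i; rewrite -!i'P ixy.
- move=> y; split=> [qy|[x <-]]; last first.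
    by apply: dval_ext => n; rewrite q'P i'P dval0; apply/ex; exists (dval x n).
  have /choice[x xP] n : exists x, i x = dval y n.
    by apply/ex; rewrite -q'P qy dval0.
  have [|x' x'P] := (dsumP x).1.
    have [N yN] := dval_supp y; exists N => n Nn; apply: inj_i.
    by rewrite xP yN // linear0.
  by exists x'; apply: dval_ext => n; rewrite i'P x'P.
- move=> z; have [N zN] := dval_supp z.
  (* Beyond the support of [z] the preimage is forced to be 0, so that the lift has finite
     support. *)
  have /choice[y yP] n : exists y, q y = dval z n /\ ((N <= n)%N -> y = 0).
    have [Nn|nN] := leqP N n; first by exists 0; rewrite zN // linear0.
    by have [y <-] := surj (dval z n); exists y.
  have [|y' y'P] := (dsumP y).1; first by exists N => n /(yP n).2.
  by exists y'; apply: dval_ext => n; rewrite q'P y'P (yP n).1.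
Qed.

Lemma projective_dsum P : projective P -> projective (dsum P).
Proof.
move=> pP L N g f surj.
have [j jP] := choice (@dsum_in R P).
have /choice[h hP] n : exists h : {linear P -> L}, forall x, g (h x) = f (j n
  x).
  exact: (pP _ _ g (compl f (j n))).
have [s sP] := dsum_fold h; exists s => x.
have [K xK] := dval_supp x.
have -> : x = \sum_(n < K) j n (dval x n).
  apply: dval_ext => n; rewrite linear_sum fct_sumE /=.
  under eq_bigr do rewrite jP.
  have [Kn|nK] := leqP K n.
    rewrite xK // big1 // => i _; rewrite gtn_eqF //.
    exact: leq_trans (ltn_ord i) Kn.
  rewrite (bigD1 (Ordinal nK)) //= eqxx big1 ?addr0 // => i ni.
  by case: eqP => // nE; case/eqP: ni; apply: val_inj.
rewrite [in LHS]linear_sum [LHS]linear_sum [RHS]linear_sum;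
  apply: eq_bigr => i _.
rewrite (sP _ i.+1); last by move=> m im; rewrite jP gtn_eqF.
rewrite linear_sum /= (bigD1 ord_max) //= hP jP eqxx big1 ?addr0 // => k ki.
rewrite hP jP ltn_eqF ?linear0 //; rewrite ltn_neqAle -ltnS ltn_ord andbT.
by apply: contra ki => /eqP ki; apply/eqP/val_inj.
Qed.

Lemma pd_at_most_dsum n M : pd_at_most n M -> pd_at_most n (dsum M).
Proof.
elim: n M => [|n IHn] M; first exact: projective_dsum.
move=> [K [P [i [q [pP iq PDK]]]]]; have [i' [q' iq']] := ses_dsum iq.
exists (dsum K), (dsum P), i', q'; split=> //; first exact: projective_dsum.
exact: IHn.
Qed.

(* The telescope presentation of ker q, the colimit of M -> M -> ... along
   the maps a n. *)
Lemma telescope M M' (t a : nat -> {linear M -> M}) (q : {linear M -> M'}) :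
  (forall n x, t n x = t n.+1 (a n x)) ->
  (forall n x, t n x = 0 -> a n x = 0) ->
  (forall x, q x = 0 <-> exists n y, t n y = x) ->
  exists (i : {linear dsum M -> dsum M}) (p : {linear dsum M -> ker_mod q}),
    ses i p.
Proof.
move=> ta t0 qE.
(* Identity minus shift along [a]; its cokernel is the colimit. Applying the [t n] to it telescopes,
   because [t n.+1] after [a n] is [t n]. *)
pose sh (x : nat -> M) n : M := x n - (if n is m.+1 then a m (x m) else 0).
have sumE (x : nat -> M) n : \sum_(k < n.+1) t k (sh x k) = t n (x n).
  elim: n => [|n IHn];
    first by rewrite big_ord_recl big_ord0 addr0 /sh /= subr0.
  by rewrite big_ord_recr /= IHn linearB /= -ta addrC subrK.
have shP (x : dsum M) : exists y : dsum M, dval y = sh (dval x).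
  have [N xN] := dval_supp x; apply/dsumP; exists N.+1 => -[//|n] Nn.
  by rewrite /sh (xN n) // linear0 subr0; apply/xN/leqW.
have [i iP] := choice shP.
have iL : linear i.
  move=> c x y; apply: dval_ext => n; rewrite dvalP !iP /sh !dvalP.
  case: n => [|n]; first by rewrite !subr0.
  by rewrite dvalP linearP scalerBr opprD addrACA.
have [s sP] := dsum_fold t.
have [|p pP] := @ex_lift R _ _ _ (ker_incl q) s (@ker_incl_inj _ _ _ _).
  move=> x; apply/exact_ker; have [N xN] := dval_supp x; rewrite (sP _ _ xN).
  by rewrite linear_sum big1 // => k _; apply/qE; exists k, (dval x k).
exists (mklin iL), p; split.
- apply: lin_inj => x ix; apply: dval_ext => n; rewrite dval0.
  have shx k : sh (dval x) k = 0 by rewrite -iP -[i x]/(mklin iL x) ix dval0.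
  elim: n => [|n IHn]; first by have := shx 0%N; rewrite /sh subr0.
  by have := shx n.+1; rewrite /sh IHn linear0 subr0.
- move=> y; split=> [py|[x <-]]; last first.
    apply: (@ker_incl_inj _ _ _ q); rewrite pP linear0.
    have [N xN] := dval_supp x; rewrite (sP _ N.+1) /=; last first.
      rewrite iP => -[//|n] Nn; rewrite /sh (xN n) // linear0 subr0.
      exact/xN/leqW.
    by rewrite iP sumE xN // linear0.
  (* The unique sequence with [sh x = y]; what remains is its finite support. *)
  pose x := fix x n := dval y n + (if n is m.+1 then a m (x m) else 0).
  have shx n : sh x n = dval y n by rewrite /sh; case: n => [|n] /=;
    rewrite addrK.
  have [N yN] := dval_supp y.
  (* Beyond the support of [y], [x n.+1] is [a n (x n)], while [t n (x n)] is the full sum of [y],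
     which is 0. The annihilator condition [t0] then gives [x n.+1 = 0]. *)
  have xN n : (N <= n)%N -> x n.+1 = 0.
    move=> Nn; rewrite /= -/x yN ?add0r; last exact: leqW.
    apply: t0; rewrite -sumE; under eq_bigr do rewrite shx.
    rewrite -sP; first by rewrite -pP py linear0.
    by move=> k nk; apply: yN; apply: leq_trans Nn (ltnW nk).
  have [|x' x'P] := (dsumP x).1; first by exists N.+1 => -[//|n] /xN.
  by exists x'; apply: dval_ext => n; rewrite /= iP x'P shx.
- move=> z;
    have /qE[n [y yE]] := (exact_ker q (ker_incl q z)).2 (ex_intro _ z erefl).
  have [j jP] := dsum_in M n; exists (j y).
  apply: (@ker_incl_inj _ _ _ q); rewrite pP -yE (sP _ n.+1); last first.
    by move=> k nk; rewrite jP gtn_eqF.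
  rewrite big_ord_recr /= jP eqxx big1 ?add0r // => k _.
  by rewrite jP ltn_eqF ?linear0.
Qed.

(** The kernel of q costs one unit as a cokernel between direct sums, and M' costs another as M
    modulo that kernel. *)
Lemma pd_at_most_telescope n M M' (t a : nat -> {linear M -> M}) (q : {linear M
  -> M'}) :
  (forall n x, t n x = t n.+1 (a n x)) ->
  (forall n x, t n x = 0 -> a n x = 0) ->
  (forall x, q x = 0 <-> exists n y, t n y = x) ->
  (forall z, exists x, q x = z) ->
  pd_at_most n M -> pd_at_most n.+2 M'.
Proof.
move=> ta t0 qE surj PDM.
have [i [p ip]] := telescope ta t0 qE.
apply: (pd_at_most_coker (ses_ker surj)); last by do 2 apply: pd_at_most_S.
by apply: (pd_at_most_coker ip); last apply: pd_at_most_S;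
  apply: pd_at_most_dsum.
Qed.

End DirectSumMap.

(** * Injective dimension *)

Section InjectiveDimension.
Variable R : comPzRingType.
Implicit Types C E L M N X Y Z : lmodType R.

Lemma injective_retraction E M (i : {linear E -> M}) :
  injective_module E -> injective i ->
  exists r : {linear M -> E}, forall x, r (i x) = x.
Proof. by move=> iE; apply: (iE _ _ i (idl E)). Qed.

Lemma injective_prod M N : injective_module M -> injective_module N ->
  injective_module (M * N)%type.
Proof.
move=> iM iN L L' g f inj_g.
have [h hP] := iM _ _ g (compl (fstl M N) f) inj_g.
have [k kP] := iN _ _ g (compl (sndl M N) f) inj_g.
by exists (pairl h k) => x; rewrite /= hP kP /=; case: (f x).
Qed.

Lemma injective_zero M : zero_module M -> injective_module M.
Proof.
move=> M0 L N g f _; exists (zerol N M) => x.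
by rewrite (M0 (f x)).
Qed.

Lemma injective_retract M N (i : {linear M -> N}) (r : {linear N -> M}) :
  (forall x, r (i x) = x) -> injective_module N -> injective_module M.
Proof.
move=> ri iN L L' g f inj_g.
have [h hP] := iN _ _ g (compl i f) inj_g.
by exists (compl r h) => x; rewrite /= hP /= ri.
Qed.

Lemma injective_ext X Y Z (i : {linear X -> Y}) (q : {linear Y -> Z}) :
  ses i q -> injective_module X -> injective_module Z -> injective_module Y.
Proof.
move=> iq iX iZ; have [inj_i _ _] := iq.
have [r rP] := injective_retraction iX inj_i.
have [s sP] := ses_section iq rP.
apply: (@injective_retract _ (X * Z)%type (pairl r q) (copairl i s)) => [y|].
  by rewrite /= -sP.
exact: injective_prod.
Qed.

Fixpoint id_at_most n M : Prop :=
  if n is n'.+1 then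
    exists (E C : lmodType R) (i : {linear M -> E}) (q : {linear E -> C}),
      [/\ injective_module E, ses i q & id_at_most n' C]
  else injective_module M.

Lemma id_at_most_S n M : id_at_most n M -> id_at_most n.+1 M.
Proof.
elim: n M => [|n IHn] M.
  move=> iM; exists M, (zero_mod R), (idl M), (zerol M _); split=> //.
    split=> // [y|z]; last by exists 0; rewrite (zero_modP z).
    by split=> // _; exists y.
  exact/injective_zero/zero_modP.
by move=> [E [C [i [q [iE iq IDC]]]]]; exists E, C, i, q; split=> //;
  apply: IHn.
Qed.

(** Dual horseshoe: extending [iX] along [i] embeds Y in [EX * EZ], and the three cokernels form a
    short exact sequence. *)
Lemma id_at_most_ext n X Y Z (i : {linear X -> Y}) (q : {linear Y -> Z}) :
  ses i q -> id_at_most n X -> id_at_most n Z -> id_at_most n Y.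
Proof.
elim: n X Y Z i q => [|n IHn] X Y Z i q iq; first exact: injective_ext iq.
move=> [EX [CX [iX [qX [iEX sX IDX]]]]] [EZ [CZ [iZ [qZ [iEZ sZ IDZ]]]]].
have [inj_i ex surj] := iq.
have [inj_iX exX surjX] := sX; have [inj_iZ exZ surjZ] := sZ.
have [r rP] := iEX _ _ i iX inj_i.
pose e := pairl r (compl iZ q).
have inj_e : injective e.
  apply: lin_inj => y [ry zqy].
  have /ex[x xE] : q y = 0 by apply: inj_iZ; rewrite zqy linear0.
  by move: ry; rewrite -xE rP => /eqP; rewrite -(linear0 iX) => /eqP/inj_iX ->;
    rewrite linear0.
have [|u uP] := @ex_desc R _ _ (coker_mod e) qX
    (compl (coker_proj e) (pairl (idl EX) (zerol EX EZ))) surjX.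
  move=> y /exX[x <-] /=; apply/exact_coker; exists (i x).
  by rewrite /= rP (ses_comp0 iq) linear0.
have [|v vP] := @ex_desc R _ _ CZ (coker_proj e) (compl qZ (sndl EX EZ))
  (@coker_proj_surj _ _ _ e).
  by move=> y /exact_coker[x <-] /=; rewrite (ses_comp0 sZ).
exists (EX * EZ)%type, (coker_mod e), e, (coker_proj e); split.
- exact: injective_prod.
- exact: ses_coker.
- apply: (IHn CX _ CZ u v) => //; split.
  + apply: lin_inj => c; have [x <-] := surjX c.
    rewrite uP /= => /exact_coker[y [<- yP]].
    have /ex[x' <-] : q y = 0 by apply: inj_iZ; rewrite yP linear0.
    by rewrite rP (ses_comp0 sX).
  + move=> c; split=> [|[x <-]]; last first.
      have [a <-] := surjX x.
      by rewrite uP vP /= linear0.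
    have [[a b] <-] := coker_proj_surj c.
    rewrite vP /= => /exZ[z zP]; have [y yP] := surj z.
    (* Modulo the image of [e], the pair (a, b) may be changed by [e y], which is (r y, b). *)
    exists (qX (a - r y)); rewrite uP /=; apply/eqP; rewrite -subr_eq0 -linearB.
    apply/eqP/exact_coker; exists (- y); rewrite !linearN /= yP zP.
    by congr (_, _) => /=; rewrite ?sub0r // addrAC subrr add0r.
  + move=> z; have [x <-] := surjZ z.
    by exists (coker_proj e (0, x)); rewrite vP.
Qed.

(* Embedding E x Z in an injective F with cokernel C embeds Z in the injective
   F / E with the same cokernel C, so no cancellation theorem is needed. *)
Lemma id_at_most_prod_injective n E Z : injective_module E -> id_at_most n (E *
  Z)%type -> id_at_most n Z.
Proof.
case: n => [|n] iE.
  by apply: (@injective_retract _ _ (pairl (zerol Z E) (idl Z)) (sndl E Z)).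
move=> [F [C [j [q [iF jq IDC]]]]]; have [inj_j ex surj] := jq.
pose k := compl j (pairl (idl E) (zerol E Z)).
have inj_k : injective k by move=> x y /inj_j[].
have [r rP] := injective_retraction iE inj_k.
(* F / E is realised as the complement [ker r] of E in F, a retract of F through [s], which is the
   projection 1 - k r. *)
pose L := ker_mod r.
have [|s sP] := @ex_lift R _ _ F (ker_incl r) (subl (idl F) (compl k r))
  (@ker_incl_inj _ _ _ _).
  by move=> x; apply/exact_ker; rewrite [subl _ _ _]/= linearB /= rP subrr.
have sl x : s (ker_incl r x) = x.
  apply: (@ker_incl_inj _ _ _ r); rewrite sP /=.
  have -> : r (ker_incl r x) = 0 by apply/exact_ker; exists x.
  by rewrite -[(0, 0)]/(0 : (E * Z)%type) linear0 subr0.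
pose l := compl s (compl j (pairl (zerol Z E) (idl Z))).
have lE z : ker_incl r (l z) = j (- r (j (0, z)), z).
  rewrite /l /= sP /= -linearB; congr (j _).
  by congr (_, _) => /=; rewrite ?sub0r ?subr0.
exists L, C, l, (compl q (ker_incl r)); split=> //.
  exact: injective_retract sl iF.
split.
- by move=> x y /(congr1 (ker_incl r)); rewrite !lE => /inj_j[].
- move=> y; split=> [/ex[[a b] abP]|[x <-]];
    last by rewrite /= lE (ses_comp0 jq).
  exists b; apply: (@ker_incl_inj _ _ _ r); rewrite lE -abP; congr (j _).
  congr (_, _).
  have : r (j (a, b)) = 0 by rewrite abP; apply/exact_ker; exists y.
  have -> : (a, b) = (a, 0) + (0, b) :> (E * Z)%type.
    by congr (_, _) => /=; rewrite ?addr0 ?add0r.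
  by rewrite !linearD (rP a) => /eqP; rewrite addr_eq0 => /eqP ->.
- move=> c; have [y <-] := surj c; exists (s y).
  rewrite /= sP /= linearB /k /= (ses_comp0 jq) subr0 //.
Qed.

(* An injective E containing X yields an exact sequence
   0 -> Y -> E x Z -> E / X -> 0. *)
Lemma id_at_most_coker n X Y Z (i : {linear X -> Y}) (q : {linear Y -> Z}) :
  ses i q -> id_at_most n X -> id_at_most n Y -> id_at_most n Z.
Proof.
(* Raising the bound first gives an embedding of X even for n = 0; its cokernel C then has dimension
   at most n, which is all the extension argument asks. *)
move=> iq /id_at_most_S[E [C [j [p [iE jp IDC]]]]] IDY.
have [inj_i ex surj] := iq; have [inj_j exj surjp] := jp.
have [h hP] := iE _ _ i j inj_i.
have [|k kP] := @ex_desc R _ _ C q (compl p h) surj.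
  by move=> y /ex[x <-]; rewrite /= hP (ses_comp0 jp).
pose u := pairl h q.
pose v := subl (compl p (fstl E Z)) (compl k (sndl E Z)).
apply: (id_at_most_prod_injective iE);
  apply: (id_at_most_ext (i := u) (q := v)) IDY IDC; split.
- apply: lin_inj => y [hy /ex[x xE]].
  by move: hy; rewrite -xE hP => /eqP; rewrite -(linear0 j) => /eqP/inj_j ->;
    rewrite linear0.
- move=> [e z]; split=> [/eqP|[y [<- <-]]]; last by rewrite /= kP subrr.
  have [y <-] := surj z; rewrite /= kP subr_eq0 => /eqP pe.
  have [x xE] := ses_sub jp pe.
  by exists (y + i x); rewrite /= !linearD hP -xE (ses_comp0 iq) addr0.
- by move=> c; have [e <-] := surjp c; exists (e, 0); rewrite /= linear0 subr0.
Qed.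

Lemma id_at_most_inj_dim_le n M : id_at_most n M -> inj_dim_le M n.
Proof.
elim: n M => [|n IHn] M.
  move=> iM.
  pose E k : lmodType R := if k is 0 then M else zero_mod R.
  pose d k : {linear E k -> E k.+1} := zerol _ _.
  exists E, d, (idl M : {linear M -> E 0%N}); split=> //.
  - by case=> // k; apply/injective_zero/zero_modP.
  - by case=> // k _; apply: zero_modP.
  - by move=> y; split=> // _; exists y.
  - move=> k y; split=> [_|[x <-]//]; exists 0.
    by rewrite linear0 (zero_modP y).
move=> [E0 [C [i [q [iE [inj_i ex surj] /IHn[E [d [e [iE' E'0 inj_e ed
  dd]]]]]]]]].
pose E' k : lmodType R := if k is k'.+1 then E k' else E0.
pose d' k : {linear E' k -> E' k.+1} :=
  match k with 0 => compl e q | k'.+1 => d k' end.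
exists E', d', (i : {linear M -> E' 0%N}); split=> //.
- by case.
- by case=> // k; apply: E'0.
- move=> y; rewrite -ex /=; split=> [qy|->]; last exact: linear0.
  by apply: inj_e; rewrite qy linear0.
- case=> [|k] y; last exact: dd.
  rewrite /d' ed; split=> [[c <-]|[x <-]]; last by exists (q x).
  by have [x <-] := surj c; exists x.
Qed.

Lemma inj_dim_le_at_most n M : inj_dim_le M n -> id_at_most n M.
Proof.
elim: n M => [|n IHn] M [E [d [e [iE E0 inj_e ed dd]]]].
  have [|s sP] := @ex_lift R _ _ (E 0%N) e (idl _) inj_e.
    by move=> x; apply/ed/E0.
  apply: injective_retract (iE 0%N) => x; apply: inj_e; exact: sP.
(* By exactness the kernel of [d 1] is the image of [d 0], so it serves as the cokernel of [e]. *)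
have [|q qP] := @ex_lift R _ _ (E 0%N) (ker_incl (d 1%N)) (d 0%N)
  (@ker_incl_inj _ _ _ _).
  by move=> x; apply/exact_ker/dd; exists x.
exists (E 0%N), (ker_mod (d 1%N)), e, q; split=> //.
  split=> // [y|z].
    rewrite -ed -qP; split=> [->|qy]; first exact: linear0.
    by apply: (@ker_incl_inj _ _ _ (d 1%N)); rewrite qy linear0.
  have /dd[x xP] : d 1%N (ker_incl (d 1%N) z) = 0 by apply/exact_ker; exists z.
  by exists x; apply: (@ker_incl_inj _ _ _ (d 1%N)); rewrite qP.
apply: IHn; exists (fun k => E k.+1), (fun k => d k.+1), (ker_incl (d 1%N)).
split=> //; [by move=> k kn; apply: E0| exact: ker_incl_inj| exact: exact_ker].
Qed.

End InjectiveDimension.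

(** * Baer's criterion and direct sums of injective modules *)

Section Baer.
Variables (R : comPzRingType) (E : lmodType R).

(** The map is a function on all of R that is linear on I only, which avoids forming I as a
    module. *)
Definition baer : Prop := forall (I : ideal R) (f : R -> E),
  (forall a x y, I x -> I y -> f (a * x + y) = a *: f x + f y) ->
  exists e, forall x, I x -> f x = x *: e.

Lemma injective_baer : injective_module E -> baer.
Proof.
move=> iE I f fL.
have IP a (x y : R^o) : I x -> I y -> I (a *: x + y).
  by move=> Ix Iy; apply: idealD => //; apply: idealMl.
pose S : submodule R^o := Submodule (ideal0 I) IP.
have fS : linear (f \o submod_incl S).
  by move=> a x y /=; rewrite -fL //; apply/(submod_inclP S);
    [exists x | exists y].
have [h hP] := iE _ _ (submod_incl S) (mklin fS) (@submod_incl_inj _ _ S).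
exists (h 1) => x Ix.
have [y yE] := (submod_inclP S x).1 Ix.
have -> : x *: h 1 = h x by rewrite -linearZ; congr (h _); apply: mulr1.
by rewrite -yE hP.
Qed.

Lemma baer_injective : baer -> injective_module E.
Proof.
move=> baerE M N g f inj_g.
(* Graphs of partial linear maps extending f along g; by linearity, single-valuedness need only be
   asked at 0. *)
pose good (G : set (N * E)) := [/\ forall m, G (g m, f m),
  forall a x y, G x -> G y -> G (a *: x + y) & forall e, G (0, e) -> e = 0].
pose graph : set (N * E) := fun x => exists m, x = (g m, f m).
have good_graph : good graph.
  split=> [m|a _ _ [m ->] [m' ->]|e [m [gm ->]]]; first by exists m.
    by exists (a *: m + m'); rewrite !linearP.
  by rewrite (inj_g m 0) ?linear0.
(* The alternative [G = set0] is there for the union of the empty chain. *)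
have [F FP totF|G [PG Gmax]] :=
    @Zorn_bigcup _ (fun G : set (N * E) => G = set0 \/ good G).
  have [[G0 [FG0 goodG0]]|noG] := pselect (exists G, F G /\ good G); last first.
    left; apply/seteqP; split=> // x [G FG Gx].
    have [GE|goodG] := FP _ FG; first by rewrite GE in Gx.
    by case: noG; exists G.
  right; split=> [m|a x y [G FG Gx] [H FH Hy]|e [G FG Ge]].
  - by exists G0 => //; case: goodG0.
  - have sub (K : set (N * E)) : F K -> K x -> K y -> (\bigcup_(X in F)
      X)%classic (a *: x + y).
      move=> FK Kx Ky; exists K => //.
      by have [KE|[_ KP _]] := FP _ FK; [rewrite KE in Kx | apply: KP].
    by have [GH|HG] := totF _ _ FG FH; [apply: (sub H) => //;
      apply: GH | apply: (sub G) => //; apply: HG].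
  - by have [GE|[_ _ G0']] := FP _ FG; [rewrite GE in Ge | apply: G0'].
have [Gg GP G_0] : good G.
  case: PG => // GE; case: (Gmax graph); last by right.
  by rewrite GE; split=> // /(_ (g 0, f 0)) []; exists 0.
have G00 : G 0 by have := Gg 0; rewrite !linear0.
have GZ a x : G x -> G (a *: x) by move=> Gx; rewrite -[_ *: _]addr0; apply: GP.
have GB x y : G x -> G y -> G (x - y).
  by move=> Gx Gy; rewrite addrC -scaleN1r; apply: GP.
have Gfun n e e' : G (n, e) -> G (n, e') -> e = e'.
  move=> Ge Ge'; apply/eqP; rewrite -subr_eq0; apply/eqP/G_0.
  by rewrite -(subrr n); apply: GB Ge Ge'.
have Gtot n : exists e, G (n, e).
  have I0 : exists e, G (0 *: n, e) by exists 0; rewrite scale0r.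
  have Iadd x y : (exists e, G (x *: n, e)) -> (exists e, G (y *: n, e)) ->
      exists e, G ((x + y) *: n, e).
    move=> [e Ge] [e' Ge']; exists (e + e'); rewrite scalerDl.
    by have := GP 1 _ _ Ge Ge'; rewrite scale1r.
  have IM a x : (exists e, G (x *: n, e)) -> exists e, G ((a * x) *: n, e).
    by move=> [e Ge]; exists (a *: e); rewrite -scalerA; apply: GZ a _ Ge.
  pose I := Ideal I0 Iadd IM.
  have /choice[k kP] x : exists e, I x -> G (x *: n, e).
    by have [[e Ge]|nI] := pselect (I x); [exists e | exists 0].
  have [|e eP] := baerE I k.
    move=> a x y Ix Iy; apply: Gfun (kP _ _) _; first exact/idealD/Iy/idealMl.
    by rewrite scalerDl -scalerA; apply: GP (kP _ Ix) (kP _ Iy).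
  (* If n is outside the domain, adjoin it with value e. By the choice of e this agrees with G on
     the multiples of n already in the domain, so maximality is contradicted. *)
  pose H : set (N * E) := fun x => exists a y, G y /\ x = (y.1 + a *: n, y.2 +
    a *: e).
  have GH : (G `<=` H)%classic.
    by move=> [y y'] Gy; exists 0, (y, y'); rewrite !scale0r !addr0.
  have Hn : H (n, e) by exists 1, 0; rewrite !scale1r !add0r.
  have goodH : good H.
    split=> [m|a _ _ [b [x [Gx ->]]] [c [y [Gy ->]]]|e' [a [[y y'] [Gy [yE
      ->]]]]].
    - exact: GH.
    - exists (a * b + c), (a *: x + y); split; first exact: GP.
      by congr (_, _) => /=; rewrite !scalerDr !scalerDl !scalerA addrACA.
    - have yN : y = (- a) *: n.
        by apply/eqP; rewrite scaleNr -addr_eq0; apply/eqP.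
      have Ia : I (- a) by exists y'; rewrite -yN.
      have := kP _ Ia; rewrite -yN => /(Gfun _ _ _ Gy) /= ->.
      by rewrite eP // scaleNr addNr.
  exists e; apply: contrapT => nGe; apply: (Gmax H); last by right.
  by split=> // /(_ _ Hn).
have [h hP] := choice Gtot.
have hL : linear h.
  by move=> a x y; apply: Gfun (hP _) _; apply: GP (hP x) (hP y).
by exists (mklin hL) => x /=; apply: Gfun (hP _) (Gg x).
Qed.

End Baer.

Section InjectiveSum.
Variables (R : comPzRingType) (R_noeth : noetherian R).
Implicit Types E M : lmodType R.

(* By Baer's criterion, only maps from finitely generated ideals matter, and
   these land in finitely many summands. *)
Lemma injective_dsum E : injective_module E -> injective_module (dsum E).
Proof.
move=> /injective_baer baerE; apply: baer_injective => I f fL.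
have f0 : f 0 = 0.
  have I0 := ideal0 I.
  by have := fL (-1) 0 0 I0 I0; rewrite mulr0 addr0 scaleN1r addNr.
have [n [g gP]] := R_noeth I.
have Ig i : I (g i) by apply/gP => J; apply; exists i.
have /choice[b bP] i : exists N, fin_supp N (dval (f (g i))) by apply:
  dval_supp.
pose N := (\max_(i < n) b i)%N.
(* An ideal inside I that contains the generators of I, hence all of I: one N bounds the supports of
   all values of f. *)
pose J x := I x /\ fin_supp N (dval (f x)).
have J0 : J 0 by split=> [|i _]; rewrite ?f0 ?dval0 //; apply: ideal0.
have Jlin a x y : J x -> J y -> J (a * x + y).
  move=> [Ix Nx] [Iy Ny]; split; first by apply: idealD => //; apply: idealMl.
  by move=> i Ni; rewrite fL // dvalP Nx // Ny // scaler0 addr0.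
have JD x y : J x -> J y -> J (x + y) by move=> Jx Jy; rewrite -[x]mul1r;
  apply: Jlin.
have JM a x : J x -> J (a * x) by move=> Jx; rewrite -[_ * _]addr0; apply: Jlin.
have IJ x : I x -> J x.
  move=> /gP /(_ (Ideal J0 JD JM)); apply=> _ [i _ <-]; split=> // k Nk.
  by apply: bP; apply: leq_trans Nk; apply: leq_bigmax.
have /choice[e eP] i : exists e, forall x, I x -> dval (f x) i = x *: e.
  by apply: baerE => a x y Ix Iy; rewrite fL // dvalP.
have [|e' e'P] := (dsumP (fun i => if (i < N)%N then e i else 0)).1.
  by exists N => i; rewrite leqNgt => /negbTE ->.
exists e' => x Ix; apply: dval_ext => i; rewrite linearZ /= e'P.
rewrite -[RHS]/(x *: (if (i < N)%N then e i else 0)).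
by case: ltnP => [_|Ni]; [apply: eP | rewrite scaler0; have [_ ->] := IJ x Ix].
Qed.

Lemma id_at_most_dsum n M : id_at_most n M -> id_at_most n (dsum M).
Proof.
elim: n M => [|n IHn] M; first exact: injective_dsum.
move=> [E [C [i [q [iE iq IDC]]]]]; have [i' [q' iq']] := ses_dsum iq.
exists (dsum E), (dsum C), i', q'; split=> //; first exact: injective_dsum.
exact: IHn.
Qed.

Lemma id_at_most_telescope n M M' (t a : nat -> {linear M -> M}) (q : {linear M
  -> M'}) :
  (forall n x, t n x = t n.+1 (a n x)) ->
  (forall n x, t n x = 0 -> a n x = 0) ->
  (forall x, q x = 0 <-> exists n y, t n y = x) ->
  (forall z, exists x, q x = z) ->
  id_at_most n M -> id_at_most n M'.
Proof.
move=> ta t0 qE surj IDM.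
have [i [p ip]] := telescope ta t0 qE.
apply: (id_at_most_coker (ses_ker surj)) => //.
by apply: (id_at_most_coker ip); apply: id_at_most_dsum.
Qed.

End InjectiveSum.

(** * Components of products of Witt vectors *)

(* Sequences built by appending F n (nth 0 s), where F n only depends on the
   first n items: the items do not depend on the length of the sequence. *)
Lemma rcons_rec_nth (W : nmodType) (s : nat -> seq W)
    (F : nat -> (nat -> W) -> W) :
  (s 0%N = [::]) -> (forall n, s n.+1 = rcons (s n) (F n (nth 0 (s n)))) ->
  (forall n f g, (forall i, (i < n)%N -> f i = g i) -> F n f = F n g) ->
  forall n, (s n.+1)`_n = F n (fun i => (s i.+1)`_i).
Proof.
move=> s0 sS Fext n.
have sz k : size (s k) = k by elim: k => [|k IHk];
  rewrite ?s0 // sS size_rcons IHk.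
have sn k i : (i < k)%N -> (s k)`_i = (s i.+1)`_i.
  elim: k => // k IHk; rewrite ltnS leq_eqVlt => /orP[/eqP ->|ik] //.
  by rewrite sS nth_rcons sz ik IHk.
by rewrite sS nth_rcons sz ltnn eqxx; apply: Fext => i /sn.
Qed.

Lemma ghost_recr p (C : comPzRingType) (X : nat -> C) n :
  ghost p X n = \sum_(i < n) p%:R ^+ i * X i ^+ (p ^ (n - i)) + p%:R ^+ n * X n.
Proof. by rewrite /ghost big_ord_recr /= subnn expr1. Qed.

Lemma mcoeff_sumU (K : choiceType) (G : zmodType) (d : {fset K}) (F : K -> G)
    k :
  (\sum_(i <- d) << F i *g i >>)@_k = if k \in d then F k else 0.
Proof.
rewrite raddf_sum /=; case: ifPn => [kd|kd].
  rewrite (big_fsetD1 k) //= mcoeffUU [X in _ + X]big1_fset ?addr0 // => i.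
  by rewrite in_fsetD1 mcoeffU => /andP[/negbTE -> _].
rewrite big1_fset // => i id _; rewrite mcoeffU.
by case: eqP kd => // <-; rewrite id.
Qed.

Section WittEvaluation.
Variables (B : comPzRingType) (v : nat + nat -> B).

Local Notation monom := {cmonom (nat + nat)%type}.
Local Notation witt_poly := {malg int[monom]}.
Implicit Types (P Q : witt_poly) (m : monom).

Definition monom_eval m : B := \prod_(i <- finsupp m) v i ^+ m i.

Lemma monom_evalEw (d : {fset (nat + nat)}) m : (finsupp m `<=` d)%fset ->
  monom_eval m = \prod_(i <- d) v i ^+ m i.
Proof.
move=> le; rewrite [LHS](big_fset_incl _ le) => //= i _.
by rewrite -cmE_eq0 => /eqP ->.
Qed.

Lemma monom_evalM m m' : monom_eval (mmul m m') = monom_eval m * monom_eval m'.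
Proof.
rewrite {1}/monom_eval mdomD (monom_evalEw (fsubsetUl _ (finsupp m'))).
rewrite (monom_evalEw (fsubsetUr (finsupp m) _)) -big_split /=.
by apply: eq_bigr => i _; rewrite cmM exprD.
Qed.

Lemma witt_poly_evalEw (d : {fset monom}) P : (msupp P `<=` d)%fset ->
  witt_poly_eval v P = \sum_(m <- d) monom_eval m *~ P@_m.
Proof.
move=> le; rewrite [LHS](big_fset_incl _ le) => //= m _ /mcoeff_outdom ->.
by rewrite mulr0z.
Qed.

Lemma witt_poly_evalU m c : witt_poly_eval v << c *g m >> = monom_eval m *~ c.
Proof. by rewrite (witt_poly_evalEw msuppU_le) big_seq_fset1 mcoeffUU. Qed.

Fact witt_poly_eval_is_additive : zmod_morphism (witt_poly_eval v).
Proof.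
move=> P Q; pose d := (msupp P `|` msupp Q)%fset.
rewrite (@witt_poly_evalEw d) ?msuppB_le // (@witt_poly_evalEw d P) ?fsubsetUl
  //.
rewrite (@witt_poly_evalEw d Q) ?fsubsetUr // -sumrB; apply: eq_bigr => m _.
by rewrite mcoeffB mulrzBr.
Qed.

HB.instance Definition _ := GRing.isZmodMorphism.Build witt_poly B
  (witt_poly_eval v) witt_poly_eval_is_additive.

Fact witt_poly_eval_is_multiplicative : monoid_morphism (witt_poly_eval v).
Proof.
split=> [|P Q].
  by rewrite -[1]/<< 1 *g mone >> witt_poly_evalU /monom_eval mdom1
    big_seq_fset0.
rewrite malgME raddf_sum /witt_poly_eval big_distrl; apply: eq_bigr => m _ /=.
rewrite raddf_sum big_distrr; apply: eq_bigr => m' _ /=.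
by rewrite witt_poly_evalU monom_evalM mulrzAr mulrzAl -mulrzA.
Qed.

HB.instance Definition _ := GRing.isMonoidMorphism.Build witt_poly B
  (witt_poly_eval v) witt_poly_eval_is_multiplicative.

Lemma witt_poly_eval_var i : witt_poly_eval v (witt_var i) = v i.
Proof.
by rewrite witt_poly_evalU /monom_eval mdomU big_seq_fset1 cmUU expr1 mulr1z.
Qed.

Lemma witt_poly_eval_ghost p (f : nat -> nat + nat) n :
  witt_poly_eval v (ghost p (fun i => witt_var (f i)) n) = ghost p (v \o f) n.
Proof.
rewrite rmorph_sum; apply: eq_bigr => i _ /=.
rewrite rmorphM !rmorphXn rmorph_nat; congr (_ * _ ^+ _).
exact: witt_poly_eval_var.
Qed.

(* The monomials that involve a variable in D are discarded; unlike an
   arbitrary substitution, this commutes with coefficientwise floor division. *)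
Record eq_off (D : pred (nat + nat)) P Q : Prop := EqOff {
  eq_off_coef : forall m, (forall i, D i -> m i = 0%N) -> P@_m = Q@_m
}.

(** Each monomial at which P and Q differ contains a variable of D, so its value lies in K. Below, K
    is an annihilator, a given ideal containing [x 0], or zero. *)
Lemma eq_off_eval (D : pred (nat + nat)) (K : ideal B) P Q :
  eq_off D P Q -> (forall i, D i -> K (v i)) ->
  K (witt_poly_eval v P - witt_poly_eval v Q).
Proof.
move=> [PQ] Kv; rewrite -raddfB /= {1}/witt_poly_eval.
apply: (big_ind K) => [||m _]; [exact: ideal0 | exact: idealD |].
have [mD|/existsNP[i /not_implyP[Di mi]]] :=
    pselect (forall i, D i -> m i = 0%N).
  by rewrite mcoeffB (PQ _ mD) subrr mulr0z; apply: ideal0.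
have im : i \in finsupp m by rewrite -cmE_neq0; apply/eqP.
rewrite -mulrzl; apply: idealMl; rewrite (big_fsetD1 i) //= mulrC.
case: (m i) mi => // k _; rewrite exprSr.
by do 2 apply: idealMl; apply: Kv.
Qed.

End WittEvaluation.

(** * Solving the ghost equations modulo a set of variables *)

Section WittCoefficients.
Variable D : pred (nat + nat).
Local Notation witt_poly := {malg int[{cmonom (nat + nat)%type}]}.
Implicit Types P Q : witt_poly.
Local Notation "P ~ Q" := (eq_off D P Q) (at level 70).

Lemma eq_off_refl P : P ~ P. Proof. by split. Qed.

Lemma eq_offD P P' Q Q' : P ~ P' -> Q ~ Q' -> P + Q ~ P' + Q'.
Proof. by move=> [PP'] [QQ']; split=> m mD; rewrite !mcoeffD PP' // QQ'. Qed.

Lemma eq_offB P P' Q Q' : P ~ P' -> Q ~ Q' -> P - Q ~ P' - Q'.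
Proof. by move=> [PP'] [QQ']; split=> m mD; rewrite !mcoeffB PP' // QQ'. Qed.

(** A monomial without variables of D factors only into monomials without variables of D. The
    supports are enlarged so that both products are sums over the same pairs. *)
Lemma eq_offM P P' Q Q' : P ~ P' -> Q ~ Q' -> P * Q ~ P' * Q'.
Proof.
move=> [PP'] [QQ']; split=> m mD.
apply: etrans (mcoeffMlw m (fsubsetUl (msupp P) (msupp P')) (fsubsetUl (msupp
  Q) (msupp Q'))) _.
apply: etrans _ (esym (mcoeffMlw m (fsubsetUr (msupp P) (msupp P')) (fsubsetUr
  (msupp Q) (msupp Q')))).
apply: eq_bigr => k _; apply: eq_bigr => l _; case: eqP => // klm.
have kl i : D i -> (k i + l i)%N = 0%N by move=> /mD; rewrite -klm cmM.
rewrite PP' ?QQ' // => i /kl /eqP; rewrite addn_eq0 => /andP[] //.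
  by move=> _ /eqP.
by move=> /eqP.
Qed.

Lemma eq_offX P Q n : P ~ Q -> P ^+ n ~ Q ^+ n.
Proof.
by move=> PQ; elim: n => [|n IHn]; [exact: eq_off_refl | rewrite !exprS;
  apply: eq_offM].
Qed.

Lemma eq_off_sum n (F G : nat -> witt_poly) : (forall i, (i < n)%N -> F i ~ G
  i) ->
  \sum_(i < n) F i ~ \sum_(i < n) G i.
Proof.
elim: n => [|n IHn] FG; first by rewrite !big_ord0; apply: eq_off_refl.
by rewrite !big_ord_recr; apply: eq_offD; [apply: IHn => i /ltnW;
  apply: FG | apply: FG].
Qed.

Lemma eq_off_ghost p n (X Y : nat -> witt_poly) :
  (forall i, (i <= n)%N -> X i ~ Y i) -> ghost p X n ~ ghost p Y n.
Proof.
move=> XY; apply: (eq_off_sum (F := fun i => p%:R ^+ i * X i ^+ (p ^ (n - i)))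
  (G := fun i => p%:R ^+ i * Y i ^+ (p ^ (n - i)))) => i i_n.
by apply: eq_offM; [apply: eq_off_refl | apply/eq_offX/XY].
Qed.

Lemma eq_off_var0 i : D i -> witt_var i ~ 0.
Proof.
move=> Di; split=> m mD; rewrite mcoeffU mcoeff0; case: eqP => // im.
by have := mD i Di; rewrite -im cmUU.
Qed.

Lemma witt_poly_div_coef P d m : (witt_poly_div P d)@_m = (P@_m %/ d)%Z.
Proof.
rewrite /witt_poly_div mcoeff_sumU; case: ifPn => // /mcoeff_outdom ->.
by rewrite div0z.
Qed.

Lemma eq_off_div P Q d : d != 0 -> P ~ d%:~R * Q -> witt_poly_div P d ~ Q.
Proof.
move=> d0 [PQ]; split=> m mD; rewrite witt_poly_div_coef PQ // mulrzl.
by rewrite raddfMz /= -mulrzr intz mulzK.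
Qed.

Variable p : nat.
Hypothesis p_gt0 : (0 < p)%N.

Lemma witt_mul_polyE n : witt_mul_poly p n = witt_poly_div
  (ghost_mul p n - \sum_(i < n) p%:R ^+ i * witt_mul_poly p i ^+ (p ^ (n - i)))
  (p%:Z ^+ n).
Proof.
apply: (@rcons_rec_nth _ (witt_mul_polys p) (fun n s => witt_poly_div
  (ghost_mul p n - \sum_(i < n) p%:R ^+ i * s i ^+ (p ^ (n - i))) (p%:Z ^+ n))).
- by [].
- by [].
- move=> k f g fg; apply: (congr1 (fun S => witt_poly_div (_ - S) _)).
  by apply: eq_bigr => i _; apply: (congr1 (fun P => _ * P ^+ _)); apply: fg.
Qed.

Lemma eq_off_witt_mul (Q : nat -> witt_poly) n :
  (forall i, (i < n)%N -> witt_mul_poly p i ~ Q i) ->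
  ghost_mul p n ~ ghost p Q n -> witt_mul_poly p n ~ Q n.
Proof.
move=> PQ gQ; rewrite witt_mul_polyE; apply: eq_off_div.
  by rewrite expf_neq0 // eqz_nat -lt0n.
have -> : (p%:Z ^+ n)%:~R * Q n =
    ghost p Q n - \sum_(i < n) p%:R ^+ i * Q i ^+ (p ^ (n - i)).
  by rewrite ghost_recr addrAC subrr add0r rmorphXn.
apply: eq_offB gQ _; apply: (@eq_off_sum n
  (fun i => p%:R ^+ i * witt_mul_poly p i ^+ (p ^ (n - i)))
  (fun i => p%:R ^+ i * Q i ^+ (p ^ (n - i)))) => i i_n.
by apply: eq_offM; [apply: eq_off_refl | apply/eq_offX/PQ].
Qed.

(** As p^i is a nonzero integer, the ghost equations have at most one solution off D. A component is
    thus found by guessing a closed form Q and checking its ghosts. *)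
Lemma eq_off_witt_mul_poly (Q : nat -> witt_poly) n :
  (forall i, (i <= n)%N -> ghost_mul p i ~ ghost p Q i) ->
  witt_mul_poly p n ~ Q n.
Proof.
elim/ltn_ind: n => n IHn gQ; apply: eq_off_witt_mul => [i i_n|]; last exact: gQ.
by apply: IHn => // j ji; apply: gQ; apply: leq_trans ji (ltnW i_n).
Qed.

End WittCoefficients.

Section WittComponents.
Variables (p : nat) (p_gt0 : (0 < p)%N) (B : comPzRingType).
Implicit Types x y : witt B.

Let v x y (i : nat + nat) : B := match i with inl j => x j | inr j => y j end.

Lemma ghost_eq0 (C : comPzRingType) (X : nat -> C) n :
  (forall i, (i <= n)%N -> X i = 0) -> ghost p X n = 0.
Proof.
move=> X0; rewrite /ghost big1 // => i _.
by rewrite (X0 _ (leq_ord i)) expr0n expn_eq0 eqn0Ngt p_gt0 mulr0.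
Qed.

Lemma ghost_last (C : comPzRingType) (X : nat -> C) n :
  (forall i, (i < n)%N -> X i = 0) -> ghost p X n = p%:R ^+ n * X n.
Proof.
move=> X0; rewrite ghost_recr big1 ?add0r // => i _.
by rewrite X0 // expr0n expn_eq0 eqn0Ngt p_gt0 mulr0.
Qed.

Lemma ghost_char x n : p%:R = 0 :> B -> ghost p x n = x 0%N ^+ (p ^ n).
Proof.
move=> p0; rewrite /ghost big_ord_recl subn0 mul1r big1 ?addr0 // => i _.
by rewrite p0 exprS !mul0r.
Qed.

(** Below k both sides vanish, and at k both are p^k w_k(X) Y_k. This checks the guesses for
    [witt_mul_coef] and [witt_mul_coef1]. *)
Lemma ghostM_last (C : comPzRingType) (X Y Q : nat -> C) k i : (i <= k)%N ->
  (forall j, (j < k)%N -> Y j = 0) -> (forall j, (j < k)%N -> Q j = 0) ->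
  Q k = ghost p X k * Y k -> ghost p Q i = ghost p X i * ghost p Y i.
Proof.
move=> i_k Y0 Q0 Qk; move: i_k; rewrite leq_eqVlt => /orP[/eqP ->|i_k].
  by rewrite (ghost_last Q0) (ghost_last Y0) Qk mulrCA.
by rewrite (ghost_eq0 (X := Q)) ?(ghost_eq0 (X := Y)) ?mulr0 // => j ji;
  [apply: Y0 | apply: Q0]; apply: leq_ltn_trans i_k.
Qed.

(** The product with a Teichmuller element [Y_0] multiplies component i by Y_0^(p^i). *)
Lemma ghostM_head (C : comPzRingType) (X Y : nat -> C) n :
  (forall j, Y j.+1 = 0) ->
  ghost p (fun i => X i * Y 0%N ^+ (p ^ i)) n = ghost p X n * ghost p Y n.
Proof.
move=> Y0; have -> : ghost p Y n = Y 0%N ^+ (p ^ n).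
  rewrite /ghost big_ord_recl subn0 mul1r big1 ?addr0 // => j _.
  by rewrite Y0 expr0n expn_eq0 eqn0Ngt p_gt0 mulr0.
rewrite /ghost big_distrl; apply: eq_bigr => j _ /=.
by rewrite -mulrA exprMn -exprM -expnD subnKC // -ltnS.
Qed.

(* If s kills the first k components of y, then so far only the summand
   w_k(X) Y_k of the polynomial P_k survives multiplication by s. *)
Lemma witt_mul_coef s k x y : p%:R = 0 :> B ->
  (forall j, (j < k)%N -> s * y j = 0) ->
  s * witt_mul p x y k = s * (x 0%N ^+ (p ^ k) * y k).
Proof.
move=> p0 sy; pose D (i : nat + nat) := if i is inr j then (j < k)%N else false.
pose W := {malg int[{cmonom (nat + nat)%type}]}.
pose X i : W := witt_var (inl i).
pose Q i : W := if i == k then ghost p X k * witt_var (inr k) else 0.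
have PQ : eq_off D (witt_mul_poly p k) (Q k).
  apply: eq_off_witt_mul_poly => // i i_k.
  pose Y j : W := if (j < k)%N then 0 else witt_var (inr j).
  have gY : eq_off D (ghost_mul p i) (ghost p X i * ghost p Y i).
    apply: eq_offM (eq_off_refl _ _) _; apply: eq_off_ghost => j ji; rewrite /Y.
    by case: ifP => jk; [apply: eq_off_var0 | apply: eq_off_refl].
  have -> : ghost p Q i = ghost p X i * ghost p Y i; last exact: gY.
  apply: (ghostM_last i_k).
  - by move=> j jk; rewrite /Y jk.
  - by move=> j jk; rewrite /Q ltn_eqF.
  - by rewrite /Q /Y eqxx ltnn.
(* The ideal is the annihilator of [s]: congruence modulo it is equality after multiplication by
   [s]. *)
have K0 : s * 0 = 0 by rewrite mulr0.
have KD b c : s * b = 0 -> s * c = 0 -> s * (b + c) = 0.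
  by move=> sb sc; rewrite mulrDr sb sc addr0.
have KM a b : s * b = 0 -> s * (a * b) = 0 by move=> sb;
  rewrite mulrCA sb mulr0.
have := @eq_off_eval _ (v x y) _ (Ideal K0 KD KM) _ _ PQ.
rewrite /= => /(_ _)/eqP; rewrite mulrBr subr_eq0 => /(_ _)/eqP ->; last first.
  by case=> // j; apply: sy.
rewrite /Q eqxx rmorphM; congr (s * (_ * _));
  last exact: (witt_poly_eval_var (v x y) (inr k)).
by apply: etrans (witt_poly_eval_ghost _ _ inl _) _; apply: ghost_char.
Qed.

(** Modulo X_0 the polynomial P_1 is X_1 (Y_0^p + p Y_1), and p vanishes in B. *)
Lemma witt_mul_coef1 (K : ideal B) x y : p%:R = 0 :> B -> K (x 0%N) ->
  K (witt_mul p x y 1%N - x 1%N * y 0%N ^+ p).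
Proof.
move=> p0 Kx; pose D (i : nat + nat) := i == inl 0%N.
pose W := {malg int[{cmonom (nat + nat)%type}]}.
pose Y i : W := witt_var (inr i).
pose Q i : W := if i == 1%N then witt_var (inl 1%N) * ghost p Y 1 else 0.
have PQ : eq_off D (witt_mul_poly p 1) (Q 1%N).
  apply: eq_off_witt_mul_poly => // i i_1.
  pose X j : W := if j == 0%N then 0 else witt_var (inl j).
  have gX : eq_off D (ghost_mul p i) (ghost p X i * ghost p Y i).
    apply: eq_offM _ (eq_off_refl _ _); apply: eq_off_ghost => j ji; rewrite /X.
    by case: eqP => [->|_]; [apply: eq_off_var0 | apply: eq_off_refl].
  have -> : ghost p Q i = ghost p X i * ghost p Y i; last exact: gX.
  rewrite mulrC; apply: (ghostM_last i_1); [by case | by case |].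
  exact: mulrC.
have := @eq_off_eval _ (v x y) _ K _ _ PQ.
have -> : witt_poly_eval (v x y) (Q 1%N) = x 1%N * y 0%N ^+ p.
  rewrite [Q 1%N]/(_ * _) rmorphM -[p in RHS]expn1; congr (_ * _).
    exact: (witt_poly_eval_var (v x y) (inl 1%N)).
  by apply: etrans (witt_poly_eval_ghost _ _ inr _) _; apply: ghost_char.
by apply=> _ /eqP ->.
Qed.

Lemma witt_mulr1 x : witt_mul p x (fun n => (n == 0%N)%:R) = x.
Proof.
apply/funext => n; set y : witt B := fun=> _.
pose D (i : nat + nat) := if i is inr j then (0 < j)%N else false.
pose W := {malg int[{cmonom (nat + nat)%type}]}.
pose X i : W := witt_var (inl i).
pose Q i : W := X i * witt_var (inr 0%N) ^+ (p ^ i).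
have PQ : eq_off D (witt_mul_poly p n) (Q n).
  apply: eq_off_witt_mul_poly => // i _.
  pose Y j : W := if j is 0 then witt_var (inr 0%N) else 0.
  have gY : eq_off D (ghost_mul p i) (ghost p X i * ghost p Y i).
    apply: eq_offM (eq_off_refl _ _) _; apply: eq_off_ghost => -[|j] ji /=.
      exact: eq_off_refl.
    exact: eq_off_var0.
  have -> : ghost p Q i = ghost p X i * ghost p Y i; last exact: gY.
  by rewrite -ghostM_head.
have K0 : 0 = 0 :> B by [].
have KD (b c : B) : b = 0 -> c = 0 -> b + c = 0 by move=> -> ->; rewrite addr0.
have KM (a b : B) : b = 0 -> a * b = 0 by move=> ->; rewrite mulr0.
have /eqP : witt_mul p x y n - witt_poly_eval (v x y) (Q n) = 0.
  by apply: (eq_off_eval (K := Ideal K0 KD KM) PQ) => -[|[]].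
rewrite subr_eq0 => /eqP ->.
rewrite /Q rmorphM rmorphXn -[RHS]mulr1 -[1 in RHS](expr1n _ (p ^ n)).
by congr (_ * _ ^+ _); [exact: (witt_poly_eval_var (v x y) (inl n))
  | exact: (witt_poly_eval_var (v x y) (inr 0%N))].
Qed.

End WittComponents.

(** * Adic topologies *)

Section AdicTopology.
Variable A : comPzRingType.
Implicit Types a b c q x y : A.

Lemma divides_refl a : divides a a. Proof. by exists 1; rewrite mul1r. Qed.

Lemma divides0 a : divides a 0. Proof. by exists 0; rewrite mul0r. Qed.

Lemma dividesD a x y : divides a x -> divides a y -> divides a (x + y).
Proof. by move=> [c ->] [d ->]; exists (c + d); rewrite mulrDl. Qed.

Lemma dividesN a x : divides a x -> divides a (- x).
Proof. by move=> [c ->]; exists (- c); rewrite mulNr. Qed.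

Lemma dividesB a x y : divides a x -> divides a y -> divides a (x - y).
Proof. by move=> ax ay; apply: dividesD => //; apply: dividesN. Qed.

Lemma divides_trans a b c : divides a b -> divides b c -> divides a c.
Proof. by move=> [d ->] [e ->]; exists (e * d); rewrite mulrA. Qed.

Lemma dividesMl a b x : divides a x -> divides a (b * x).
Proof. by move=> [c ->]; exists (b * c); rewrite mulrA. Qed.

Lemma dividesMr a b x : divides a x -> divides a (x * b).
Proof. by rewrite mulrC; apply: dividesMl. Qed.

Lemma dividesM a b x y : divides a x -> divides b y -> divides (a * b) (x * y).
Proof. by move=> [c ->] [d ->]; exists (c * d); rewrite mulrACA. Qed.

Lemma divides_sub a x y z : divides a (x - y) -> divides a (y - z) -> divides a
  (x - z).
Proof. by move=> xy yz; rewrite -(subrK y x) -addrA; apply: dividesD. Qed.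

Lemma divides_subC a x y : divides a (x - y) -> divides a (y - x).
Proof. by move=> xy; rewrite -opprB; apply: dividesN. Qed.

Lemma divides_exp a b n : divides a b -> divides (a ^+ n) (b ^+ n).
Proof. by move=> [c ->]; exists (c ^+ n); rewrite exprMn. Qed.

Lemma divides_expS a m n : (m <= n)%N -> divides (a ^+ m) (a ^+ n).
Proof. by move=> mn; exists (a ^+ (n - m)); rewrite -exprD subnK. Qed.

Lemma divides_subM a x x' y y' : divides a (x - x') -> divides a (y - y') ->
  divides a (x * y - x' * y').
Proof.
move=> xx' yy';
  have -> : x * y - x' * y' = (x - x') * y + x' * (y - y') by ring.
by apply: dividesD; [apply: dividesMr | apply: dividesMl].
Qed.

Lemma adic_cvg_unique a u x y : adic_separated a ->
  adic_cvg a u x -> adic_cvg a u y -> x = y.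
Proof.
move=> sep ux uy; apply/eqP; rewrite -subr_eq0; apply/eqP/sep => n.
have [N ux'] := ux n; have [K uy'] := uy n; pose m := maxn N K.
apply: (divides_sub (y := u m)); last by apply: uy'; apply: leq_maxr.
by apply/divides_subC/ux'; apply: leq_maxl.
Qed.

Lemma adic_limE a u x : adic_separated a -> adic_cvg a u x -> adic_lim a u = x.
Proof.
by move=> sep ux; apply: xget_unique => // y uy; apply: adic_cvg_unique uy ux.
Qed.

Lemma adic_series_tail a (d : nat -> A) m n : (m <= n)%N ->
  divides (a ^+ m) (\sum_(i < n) a ^+ i * d i - \sum_(i < m) a ^+ i * d i).
Proof.
move=> /subnK <-; elim: (n - m)%N => [|k IHk]; first by rewrite add0n subrr;
  apply: divides0.
rewrite addSn big_ord_recr /= addrAC; apply: dividesD => //.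
by apply/dividesMr/divides_expS/leq_addl.
Qed.

Lemma adic_series a (d : nat -> A) : adic_complete a ->
  exists s, forall n, divides (a ^+ n) (s - \sum_(i < n) a ^+ i * d i).
Proof.
move=> [_ compl]; have [n|s sP] := compl (fun n => \sum_(i < n) a ^+ i * d i).
  exists n => k m nk nm; apply: (divides_sub (y := \sum_(i < n) a ^+ i * d i)).
    exact: adic_series_tail.
  exact/divides_subC/adic_series_tail.
exists s => n; have [N NP] := sP n; pose m := maxn N n.
apply: (divides_sub (y := \sum_(i < m) a ^+ i * d i)).
  by apply/divides_subC/NP; apply: leq_maxl.
exact/adic_series_tail/leq_maxr.
Qed.

(** The inverse is the geometric series in - a x. *)
Lemma adic_unit a x : adic_complete a -> exists y, (1 + a * x) * y = 1.
Proof.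
move=> ca; have [s sP] := adic_series (fun i => (- x) ^+ i) ca.
exists s; apply/eqP; rewrite -subr_eq0; apply/eqP/ca.1 => n.
apply: (divides_sub (y := (1 + a * x) * \sum_(i < n) a ^+ i * (- x) ^+ i)).
  by rewrite -mulrBr; apply: dividesMl.
have -> : 1 + a * x = 1 - a * - x by rewrite mulrN opprK.
under eq_bigr do rewrite -exprMn.
rewrite -[1 - a * _]opprB mulNr -subrX1 opprB addrAC subrr add0r exprMn.
exact/dividesN/dividesMr/divides_refl.
Qed.

(** An a-adic limit of a b-adic Cauchy sequence is at first close to it only a-adically. Writing
    each tail as b^n times an a-adically convergent series gives b-adic closeness. *)
Lemma adic_complete_divides a b : divides a b -> adic_complete a ->
  adic_complete b.
Proof.
move=> [c bE] ca; have ab n : divides (a ^+ n) (b ^+ n).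
  by apply: divides_exp; exists c.
split=> [x bx|u uC]; first by apply: ca.1 => n; apply: divides_trans (bx n).
have [N NP] := choice uC.
(* Partial sums give thresholds that dominate the [N n] and are also monotone. *)
pose M n := (\sum_(i < n.+1) N i)%N.
have NM n : (N n <= M n)%N by rewrite /M big_ord_recr leq_addl.
have M_S n : (M n <= M n.+1)%N by rewrite {2}/M big_ord_recr leq_addr.
have /choice[d dP] n : exists d, u (M n.+1) - u (M n) = d * b ^+ n.
  by apply: NP => //; apply: leq_trans (M_S n).
have tele n k : u (M (n + k)%N) - u (M n) = b ^+ n * \sum_(i < k) b ^+ i * d (n
  + i)%N.
  elim: k => [|k IHk]; first by rewrite addn0 subrr big_ord0 mulr0.
  rewrite addnS big_ord_recr mulrDr -IHk /= mulrA -exprD mulrC -dP.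
  by rewrite [RHS]addrC addrA subrK.
have ser n : exists s, forall k, divides (a ^+ k) (s - \sum_(i < k) b ^+ i * d
  (n + i)%N).
  have [s sP] := adic_series (fun i => c ^+ i * d (n + i)%N) ca.
  exists s => k; have := sP k; congr (divides _ (_ - _)); apply: eq_bigr => i _.
  by rewrite bE exprMn mulrA (mulrC (c ^+ i)).
have [s sP] := choice ser.
pose x := u (M 0%N) + s 0%N.
(* An exact identity: both sides agree modulo every a^k, and A is a-adically separated. *)
have xE n : x = u (M n) + b ^+ n * s n.
  apply/eqP; rewrite -subr_eq0; apply/eqP/ca.1 => k.
  have [e] := sP 0%N (n + k)%N; under eq_bigr do rewrite add0n; move=> eP.
  have [e' e'P] := sP n k.
  have t0 : u (M (n + k)%N) - u (M 0%N) = \sum_(i < n + k) b ^+ i * d i.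
    have := tele 0%N (n + k)%N; rewrite add0n expr0 mul1r => ->.
    by under eq_bigr do rewrite add0n.
  have tn := tele n k.
  have -> : x - (u (M n) + b ^+ n * s n) =
    (s 0%N - \sum_(i < n + k) b ^+ i * d i)
    - b ^+ n * (s n - \sum_(i < k) b ^+ i * d (n + i)%N).
    rewrite -t0 mulrBr -tn /x; ring.
  rewrite eP e'P; apply: dividesB; apply/dividesMl;
    last exact/dividesMl/divides_refl.
  exact/divides_expS/leq_addl.
exists x => n; exists (M n) => m Mm; rewrite (xE n).
apply: (divides_sub (y := u (M n))).
  by apply: NP => //; apply: leq_trans Mm.
by rewrite opprD addrA subrr add0r; apply/dividesN/dividesMr/divides_refl.
Qed.

End AdicTopology.

(** * Tilts and Teichmuller expansions *)

Section Tilting.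
Variables (p : nat) (p_prime : prime p) (A : comPzRingType).
Local Notation q := (p%:R : A).
Local Notation Ap := (Defs.modp p A).
Local Notation B := (@Defs_tilt__canonical__GRing_ComPzRing p p_prime A).
Implicit Types (x y z : B) (a b : A).

Definition pr (a : A) : Ap := proj _ a.

Fact pr_is_additive : zmod_morphism pr.
Proof.
by move=> a b; apply: (addIr (pr b)); rewrite -[LHS]projD !subrK.
Qed.

Fact pr_is_multiplicative : monoid_morphism pr.
Proof. by split=> // a b; apply: projM. Qed.

HB.instance Definition _ := GRing.isZmodMorphism.Build A Ap pr pr_is_additive.
HB.instance Definition _ :=
  GRing.isMonoidMorphism.Build A Ap pr pr_is_multiplicative.

Lemma prP a b : pr a = pr b <-> divides q (a - b).
Proof.
split=> [/projP ab|[c cE]]; last first.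
  by apply/projP => J Jq; rewrite cE; apply/idealMl/Jq.
pose K := Ideal (divides0 q) (@dividesD _ q) (@dividesMl _ q).
by apply: (ab K) => _ ->; apply: divides_refl.
Qed.

Lemma pr_eq0 a : pr a = 0 <-> divides q a.
Proof. by rewrite -(rmorph0 pr) prP subr0. Qed.

Lemma pr_repr (c : Ap) : pr (repr c) = c. Proof. exact: reprK_proj. Qed.

(** In the factorisation of a^p - b^p by a - b, the cofactor is a sum of p terms, each congruent to
    b^(p-1) modulo p, so it contributes one more factor p. *)
Lemma divides_Frobenius a b i : divides (q ^+ i.+1) (a - b) ->
  divides (q ^+ i.+2) (a ^+ p - b ^+ p).
Proof.
move=> ab; rewrite subrXX exprSr; apply: dividesM => //; apply/pr_eq0.
have prab : pr a = pr b.
  by apply/prP; apply: divides_trans ab; rewrite exprS;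
    apply: dividesMr (divides_refl _).
rewrite rmorph_sum (eq_bigr (fun=> pr b ^+ p.-1)) => [|k _].
  rewrite sumr_const card_ord -mulr_natl.
  by rewrite (modp_p p A) mul0r.
rewrite rmorphM !rmorphXn /= prab -exprD; congr (_ ^+ _).
by rewrite subnK // -ltnS prednK ?prime_gt0.
Qed.

Lemma divides_Frobenius_iter a b k : divides q (a - b) ->
  divides (q ^+ k.+1) (a ^+ (p ^ k) - b ^+ (p ^ k)).
Proof.
elim: k => [|k IHk] ab; first by rewrite !expn0 !expr1.
by rewrite !expnSr !exprM; apply/divides_Frobenius/IHk.
Qed.

Lemma tilt_seqX x m n : tilt_seq (x ^+ m) n = tilt_seq x n ^+ m.
Proof. by elim: m => [|m IHm] //; rewrite !exprS -IHm. Qed.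

Lemma tilt_seqM x y n : tilt_seq (x * y) n = tilt_seq x n * tilt_seq y n.
Proof. by []. Qed.

Lemma tilt_seqS x n : tilt_seq x n.+1 ^+ p = tilt_seq x n.
Proof. by have /asboolP := tilt_seqP x; apply. Qed.

Lemma tilt_ext x y : (forall n, tilt_seq x n = tilt_seq y n) -> x = y.
Proof. by move=> xy; apply/val_inj/funext. Qed.

Lemma tilt_char : p%:R = 0 :> B.
Proof.
apply: tilt_ext => n; have natE k : tilt_seq (k%:R : B) n = k%:R.
  by elim: k => // k IHk; rewrite !mulrS -IHk.
by rewrite natE; apply: modp_p.
Qed.

Definition troot n x : B := tilt_root n x.

Lemma trootK n x : troot n x ^+ (p ^ n) = x.
Proof.
apply: tilt_ext => k; rewrite tilt_seqX /=.
elim: n k => [|n IHn] k; first by rewrite expr1.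
by rewrite expnS exprM addSn tilt_seqS IHn.
Qed.

Lemma trootX n x m : troot n (x ^+ m) = troot n x ^+ m.
Proof.
by apply: tilt_ext => k; rewrite tilt_seqX; apply: (tilt_seqX x m (n + k)).
Qed.

Lemma troot_root n x : troot n (x ^+ (p ^ n)) = x.
Proof. by rewrite trootX trootK. Qed.

Lemma troot_inj n x y : x ^+ (p ^ n) = y ^+ (p ^ n) -> x = y.
Proof. by move=> /(congr1 (troot n)); rewrite !troot_root. Qed.

Lemma troot_add n m x : troot (n + m) x ^+ (p ^ m) = troot n x.
Proof.
by apply: (@troot_inj n); rewrite -exprM -expnD [(m + n)%N]addnC !trootK.
Qed.

Lemma tilt_reduced x m : x ^+ m = 0 -> x = 0.
Proof.
move=> xm; apply: (@troot_inj m).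
rewrite expr0n expn_eq0 eqn0Ngt prime_gt0 //=.
have mp : (m <= p ^ m)%N by apply/ltnW/ltn_expl/prime_gt1.
by rewrite -(subnK mp) exprD xm mulr0.
Qed.

Hypothesis q_complete : adic_complete q.

(** The estimate holds for every lift of the k-th component, so nothing later depends on the
    representatives chosen in [sharp]. *)
Lemma sharp_approx_ex x : exists s : A, forall k a, pr a = tilt_seq x k ->
  divides (q ^+ k.+1) (s - a ^+ (p ^ k)).
Proof.
pose u k : A := repr (tilt_seq x k) ^+ (p ^ k).
have uS k : divides (q ^+ k.+1) (u k.+1 - u k).
  rewrite /u expnS exprM; apply/divides_Frobenius_iter/prP.
  by rewrite rmorphXn /= !pr_repr tilt_seqS.
have /choice[d dP] k : exists d, u k.+1 - u k = q ^+ k * d.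
  by have [c ->] := uS k; exists (c * q); rewrite exprSr; ring.
have [s sP] := adic_series d q_complete.
have uE k : u k = u 0%N + \sum_(i < k) q ^+ i * d i.
  elim: k => [|k IHk]; first by rewrite big_ord0 addr0.
  by rewrite big_ord_recr /= -dP addrA -IHk addrC subrK.
(* The series is within p^n of its n-th partial sum, so the exponent k+1 requires a comparison with
   [u k.+1], not [u k]. *)
exists (u 0%N + s) => k a ak; apply: (divides_sub (y := u k.+1)).
  by rewrite (uE k.+1) opprD addrACA subrr add0r.
apply: (divides_sub (y := u k)) => //.
by apply/divides_Frobenius_iter/prP; rewrite pr_repr ak.
Qed.

Lemma sharp_approx x k a : pr a = tilt_seq x k ->
  divides (q ^+ k.+1) (sharp x - a ^+ (p ^ k)).
Proof.
have [s sP] := sharp_approx_ex x.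
suff -> : sharp x = s by apply: sP.
apply: adic_limE (q_complete.1) _ => n; exists n => m nm.
apply: divides_trans (divides_expS q (leqW nm)) _.
by apply/divides_subC/sP; rewrite pr_repr.
Qed.

Lemma sharp_unique x (s : A) :
  (forall k, exists2 a, pr a = tilt_seq x k & divides (q ^+ k) (s - a ^+ (p ^
    k))) ->
  sharp x = s.
Proof.
move=> sx; apply/eqP; rewrite -subr_eq0; apply/eqP/q_complete.1 => n.
have [a an sa] := sx n; apply: (divides_sub (y := a ^+ (p ^ n))).
  by apply: divides_trans (sharp_approx an); apply: divides_expS.
exact: divides_subC.
Qed.

Lemma sharpM x y : sharp (x * y) = sharp x * sharp y.
Proof.
apply: sharp_unique => k; exists (repr (tilt_seq x k) * repr (tilt_seq y k)).
  by rewrite rmorphM /= !pr_repr.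
apply: divides_trans (divides_expS q (leqnSn k)) _; rewrite exprMn.
by apply: divides_subM; apply: sharp_approx; apply: pr_repr.
Qed.

Lemma sharp1 : sharp (1 : B) = 1.
Proof.
by apply: sharp_unique => k; exists 1; rewrite ?rmorph1 // expr1n subrr;
  apply: divides0.
Qed.

Lemma sharp0 : sharp (0 : B) = 0.
Proof.
apply: sharp_unique => k; exists 0; rewrite ?rmorph0 //.
by rewrite expr0n expn_eq0 eqn0Ngt prime_gt0 // subrr; apply: divides0.
Qed.

Lemma sharpX x n : sharp (x ^+ n) = sharp x ^+ n.
Proof. by elim: n => [|n IHn]; [exact: sharp1 | rewrite !exprS sharpM IHn]. Qed.

Lemma pr_sharp x : pr (sharp x) = tilt_seq x 0.
Proof.
by have := sharp_approx (pr_repr (tilt_seq x 0)); rewrite !expr1 => /prP ->;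
  apply: pr_repr.
Qed.

(* a = \sum_i p^i (c i)^sharp, the value under theta of the Witt vector with
   components (c i)^(p^i). *)
Definition expansion (a : A) (c : nat -> B) : Prop :=
  forall n, divides (q ^+ n) (a - \sum_(i < n) q ^+ i * sharp (c i)).

Lemma expansion_unique a b c : expansion a c -> expansion b c -> a = b.
Proof.
move=> ac bc; apply/eqP; rewrite -subr_eq0; apply/eqP/q_complete.1 => n.
exact: divides_sub (ac n) (divides_subC (bc n)).
Qed.

Lemma expansion_sum c : exists a, expansion a c.
Proof. exact: (adic_series (fun i => sharp (c i)) q_complete). Qed.

Definition scons (z : B) (c : nat -> B) i := if i is j.+1 then c j else z.

Lemma expansion_cons a c z : expansion a c ->
  expansion (sharp z + q * a) (scons z c).
Proof.
move=> ac [|n];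
  first by exists (sharp z + q * a - \sum_(i < 0) q ^+ i * sharp (scons z c
    i)); rewrite mulr1.
rewrite big_ord_recl expr0 mul1r opprD addrACA subrr add0r.
under eq_bigr do rewrite exprS -mulrA.
by rewrite -big_distrr -mulrBr exprS; apply: dividesM;
  [apply: divides_refl | apply: ac].
Qed.

Lemma expansion_head a c : expansion a c ->
  exists2 b, a = sharp (c 0%N) + q * b & expansion b (c \o S).
Proof.
move=> ac; have [b bc] := expansion_sum (c \o S); exists b => //.
apply: (expansion_unique ac).
have -> : c = scons (c 0%N) (c \o S) by apply/funext; case.
exact: expansion_cons.
Qed.

Lemma pr_expansion a c : expansion a c -> pr a = tilt_seq (c 0%N) 0.
Proof.
by move=> /expansion_head[b -> _];
  rewrite rmorphD rmorphM rmorph_nat /= (modp_p p A) mul0r addr0 pr_sharp.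
Qed.

Lemma theta_expansion a c : expansion a c -> theta (fun i => c i ^+ (p ^ i)) =
  a.
Proof.
move=> ac; apply: adic_limE (q_complete.1) _ => n; exists n => m nm.
apply: divides_trans (divides_expS q nm) _; apply: divides_subC.
have := ac m; congr (divides _ (_ - _)); apply: eq_bigr => i _.
by congr (_ * sharp _); rewrite -[tilt_root _ _]/(troot _ _) troot_root.
Qed.

Hypothesis Frobenius_surj : forall x : Ap, exists y : Ap, y ^+ p = x.

Lemma tilt_lift (c : Ap) : exists x, tilt_seq x 0 = c.
Proof.
have [f fP] := choice Frobenius_surj.
have fT : is_tilt (fun n => iter n f c) by apply/asboolP => n /=; rewrite fP.
by exists (Tilt fT).
Qed.

Lemma sharp_decomp a : exists z b, a = sharp z + q * b.
Proof.
have [z zP] := tilt_lift (pr a); exists z.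
have /prP[b bE] : pr a = pr (sharp z) by rewrite pr_sharp zP.
by exists b; rewrite mulrC -bE addrC subrK.
Qed.

Lemma expansion_ex a : exists c, expansion a c.
Proof.
(* [z] picks the leading coefficient and [r] the remainder divided by p; iterating [r] yields all
   coefficients. *)
have /choice[z /choice[r zr]] a' := sharp_decomp a'.
exists (fun i => z (iter i r a)) => n; exists (iter n r a); apply/eqP.
rewrite subr_eq; apply/eqP; elim: n => [|n IHn];
  first by rewrite mulr1 big_ord0 addr0.
rewrite [LHS]IHn big_ord_recr /= {1}(zr (iter n r a)) exprSr; ring.
Qed.

Lemma expansion_shift k a c : expansion a c ->
  expansion (q ^+ k * a) (iter k (scons 0) c).
Proof.
move=> ac; elim: k => [|k IHk]; first by rewrite mul1r.
by have := expansion_cons 0 IHk; rewrite sharp0 add0r mulrA -exprS.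
Qed.

Lemma iter_scons_lt k c i : (i < k)%N -> iter k (scons 0) c i = 0.
Proof. by elim: k i => // k IHk [|i] //= /IHk. Qed.

Lemma iter_scons_eq k c : iter k (scons 0) c k = c 0%N.
Proof. by elim: k. Qed.

End Tilting.

(** * The radical of p in a perfectoid ring *)

Section Perfectoid.
Variables (p : nat) (p_prime : prime p) (A : comPzRingType).
Local Notation q := (p%:R : A).
Local Notation Ap := (Defs.modp p A).
Local Notation B := (@Defs_tilt__canonical__GRing_ComPzRing p p_prime A).
Local Notation p_gt0 := (prime_gt0 p_prime).
Local Notation charB := (tilt_char p_prime A).
Implicit Types (x y z : B) (a b : A).

Lemma perfectoid_complete : perfectoid p_prime A -> adic_complete q.
Proof.
move=> [[pi [pi_p compl]] _ _]; apply: adic_complete_divides compl.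
apply: divides_trans pi_p; rewrite -{1}[pi]expr1.
exact: divides_expS p_gt0.
Qed.

Section Kernel.
Hypothesis q_complete : adic_complete q.
Hypothesis Frobenius_surj : forall x : Ap, exists y : Ap, y ^+ p = x.
Variable xi : witt B.
Hypothesis xiP : forall x : witt B,
  theta x = 0 <-> exists w : witt B, x = witt_mul p xi w.
Hypothesis pi_ex : exists pi : A, divides (pi ^+ p) q /\ adic_complete pi.

Local Notation expands := (@expansion p p_prime A).

(** The bridge from A to A^flat: a vanishing infinite sum becomes a family of equations between tilt
    elements. *)
Lemma expansion0_kernel c : expands 0 c ->
  exists w : witt B, forall i, c i ^+ (p ^ i) = witt_mul p xi w i.
Proof.
move=> /(theta_expansion q_complete)/xiP[w cw]; exists w => i.
exact: (congr1 (fun f => f i) cw).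
Qed.

Definition xi_root i : B := troot i (xi i).

(** xi lies in the kernel it generates, being its own product with the Witt vector (1, 0, 0,
    ...). *)
Lemma expansion_xi : expands 0 xi_root.
Proof.
have [a ac] := expansion_sum q_complete xi_root.
suff <- : a = 0 by [].
rewrite -(theta_expansion q_complete ac); apply/xiP.
exists (fun n => (n == 0%N)%:R); rewrite (witt_mulr1 p_gt0).
by apply/funext => i; apply: trootK.
Qed.

(* varpi 0 = xi_0^sharp is an associate of p, and varpi n is its p^n-th root. *)
Definition varpi_flat n : B := troot n (xi 0%N).
Definition varpi n : A := sharp (varpi_flat n).

Lemma varpi_flatX n m : varpi_flat (n + m) ^+ (p ^ m) = varpi_flat n.
Proof. exact: troot_add. Qed.

Lemma varpiX n m : varpi (n + m) ^+ (p ^ m) = varpi n.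
Proof. by rewrite /varpi -(sharpX q_complete) varpi_flatX. Qed.

Lemma varpi_flat0 : varpi_flat 0 = xi 0%N.
Proof. exact: trootK 0 (xi 0%N). Qed.

(* Replacing pi by its unit multiple y^sharp, p = c' (y^sharp)^p; expanding - c'
   gives the coefficient 1 + (multiple of pi) at p. *)
Lemma unit_expansion0 : exists c (u : Ap), expands 0 c /\ tilt_seq (c 1%N) 0 *
  u = 1.
Proof.
have [pi [[c qE] compl]] := pi_ex.
have unit_pi a : exists b, (1 + pi * a) * b = 1 by apply: adic_unit.
(* As pi^p divides p and p >= 2, the error p d is a multiple of pi^2; so y^sharp is pi times a unit
   [U] of the form 1 + pi (...). *)
have [y [d yE]] : exists y d, sharp y = pi + q * d.
  have [y yP] := tilt_lift p_prime Frobenius_surj (pr p pi); exists y.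
  have /prP[d dE] : pr p (sharp y) = pr p pi by rewrite (pr_sharp q_complete)
    yP.
  by exists d; rewrite mulrC -dE addrC subrK.
have pE : p = p.-2.+2 by case: (p) (prime_gt1 p_prime) => [|[]].
have [u' u'E] := unit_pi (pi ^+ p.-2 * c * d).
pose U := 1 + pi * (pi ^+ p.-2 * c * d); rewrite -/U in u'E.
have yE' : sharp y = pi * U.
  by rewrite yE qE {1}pE !exprS /U; ring.
pose Y := sharp (y ^+ p); pose c' := c * u' ^+ p.
have qY : q = c' * Y.
  rewrite /Y (sharpX q_complete) yE' exprMn /c' mulrACA -[in RHS]mulrA.
  rewrite mulrA mulrAC -exprMn.
  by rewrite [u' * _]mulrC u'E expr1n mulr1.
have [c0 [c'' c'E]] := sharp_decomp p_prime q_complete Frobenius_surj (- c').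
have [vs vsP] := expansion_ex p_prime q_complete Frobenius_surj (1 + Y * c'').
(* With - c' = c0^sharp + p c'', the relation p - c' Y = 0 reads (y^p c0)^sharp + p (1 + Y c'') = 0,
   where Y is a multiple of pi. *)
exists (scons (y ^+ p * c0) vs).
have [v' v'E] : exists v', (1 + Y * c'') * v' = 1.
  have := unit_pi (pi ^+ p.-1 * U ^+ p * c'').
  by rewrite !mulrA -exprS (prednK p_gt0) -exprMn -yE' -(sharpX q_complete).
exists (pr p v'); split.
  have -> : 0 = sharp (y ^+ p * c0) + q * (1 + Y * c'').
    rewrite (sharpM q_complete) -/Y.
    have -> : sharp c0 = - c' - q * c'' by rewrite c'E addrK.
    have -> : Y * (- c' - q * c'') + q * (1 + Y * c'') = q - c' * Y by ring.
    by rewrite -qY subrr.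
  exact: expansion_cons.
by rewrite /= -(pr_expansion q_complete vsP) -rmorphM v'E rmorph1.
Qed.

Lemma varpi0_head : exists2 v, varpi 0 = - (q * v) & pr p v = tilt_seq (xi_root
  1) 0.
Proof.
have [v v0 vP] := expansion_head q_complete expansion_xi.
exists v; last exact: pr_expansion vP.
apply/eqP; rewrite -addr_eq0 eq_sym; apply/eqP.
by rewrite [LHS]v0.
Qed.

Lemma divides_q_varpi : divides q (varpi 0).
Proof.
by have [v -> _] := varpi0_head; apply/dividesN/dividesMr/divides_refl.
Qed.

(** Compare component 1 of the kernel element of [unit_expansion0] with that of xi w, which is xi_1
    w_0^p modulo xi_0. As the former is invertible modulo p, so is xi_1, hence also [v]. *)
Lemma divides_varpi_q : divides (varpi 0) q.
Proof.
have [v vE prv] := varpi0_head.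
suff [v' vv'] : exists v', v * v' = 1.
  by exists (- v'); rewrite vE mulrNN mulrCA (mulrC v') vv' mulr1.
have [c [u [c0 cu]]] := unit_expansion0.
have [w wP] := expansion0_kernel c0.
(* The kernel of A^flat -> A/pA; it contains xi_0 because p divides xi_0^sharp. *)
pose K0 (x : B) := tilt_seq x 0 = 0.
have K00 : K0 0 by [].
have KD x y : K0 x -> K0 y -> K0 (x + y).
  by rewrite /K0 -[tilt_seq (x + y) 0]/(tilt_seq x 0 + tilt_seq y 0) => -> ->;
    rewrite addr0.
have KM x y : K0 y -> K0 (x * y).
  by rewrite /K0 tilt_seqM => ->; rewrite mulr0.
have := @witt_mul_coef1 _ p_gt0 _ (Ideal K00 KD KM) xi w charB.
have K0xi : K0 (xi 0%N).
  rewrite /K0 -varpi_flat0 -(pr_sharp q_complete); apply/pr_eq0.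
  exact: divides_q_varpi.
move=> /(_ K0xi); rewrite -wP expn1 => /eqP.
rewrite -[tilt_seq (_ - _) _]/(tilt_seq (c 1%N ^+ p) 0 - tilt_seq (xi 1%N * w
  0%N ^+ p) 0).
rewrite subr_eq0 tilt_seqM !tilt_seqX => /eqP c1E.
have xi1 : tilt_seq (xi 1%N) 0 = tilt_seq (xi_root 1) 0 ^+ p.
  by rewrite -[in LHS](trootK 1 (xi 1%N)) expn1 tilt_seqX.
pose t := tilt_seq (w 0%N) 0 * u.
have vt : pr p v ^+ p * t ^+ p = 1.
  by rewrite prv -xi1 exprMn mulrA -c1E -exprMn cu expr1n.
have /prP[e eE] : pr p (v * (v ^+ p.-1 * repr t ^+ p)) = pr p 1.
  rewrite mulrA -exprS (prednK p_gt0) rmorphM !rmorphXn /= pr_repr vt.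
  by rewrite rmorph1.
(* [v] is invertible modulo p, and completeness lifts this to A. *)
have [f fE] := adic_unit e q_complete.
exists (v ^+ p.-1 * repr t ^+ p * f); rewrite mulrA.
by rewrite -[RHS]fE; congr (_ * _); rewrite (mulrC _ e) -eE addrC subrK.
Qed.

(** With z the leading coefficient of a, p divides (z^(p^k))^sharp, so z^(p^k) is component 0 of a
    kernel element, hence a multiple of xi_0. Extracting p^k-th roots in A^flat makes z a multiple
    of [varpi_flat k]. *)
Lemma radical_varpi k a : divides q (a ^+ (p ^ k)) -> divides (varpi k) a.
Proof.
move=> qa; have [z [b aE]] := sharp_decomp p_prime q_complete Frobenius_surj a.
have [d dE] : divides q (sharp (z ^+ (p ^ k))).
  apply/pr_eq0; rewrite (sharpX q_complete) rmorphXn /=.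
  have -> : pr p (sharp z) = pr p a.
    by rewrite aE rmorphD rmorphM rmorph_nat /= (modp_p p A) mul0r addr0.
  by rewrite -rmorphXn; apply/pr_eq0.
have [c cP] := expansion_ex p_prime q_complete Frobenius_surj (- d).
have /expansion0_kernel[w wP] : expands 0 (scons (z ^+ (p ^ k)) c).
  have := expansion_cons (z ^+ (p ^ k)) cP.
  by rewrite dE mulrN [q * d]mulrC subrr.
(* The case s = 1, k = 0 of [witt_mul_coef]: component 0 of a product is the product of the
   components 0. *)
have := wP 0%N; rewrite expr1 /= -[witt_mul _ _ _ _]mul1r.
rewrite (witt_mul_coef p_gt0) // ?charB // mul1r expr1 => zE.
have zE' : z = varpi_flat k * troot k (w 0%N).
  by apply: (@troot_inj _ p_prime _ k); rewrite zE exprMn !trootK.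
rewrite aE zE' (sharpM q_complete); apply: dividesD.
  exact/dividesMr/divides_refl.
apply/dividesMr/(divides_trans _ divides_varpi_q).
by rewrite -(varpiX 0 k) add0n -{1}[varpi k]expr1; apply/divides_expS;
  rewrite expn_gt0 p_gt0.
Qed.

(* Since A^flat is reduced and perfect, torsion for a power of xi_0 is
   killed by every root of xi_0. *)
Lemma varpi_flat_torsion m n N x :
  varpi_flat m * (varpi_flat 0 ^+ N * x) = 0 -> varpi_flat n * x = 0.
Proof.
(* The p^k-th power of [varpi_flat n] is xi_0^(p^(N+1)), with at least N+1 factors xi_0: N of them
   match the hypothesis, and one more supplies [varpi_flat m]. *)
move=> Nx; pose k := (n + N.+1)%N.
have kE : varpi_flat n ^+ (p ^ k) = varpi_flat 0 ^+ (p ^ N.+1).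
  by rewrite /k expnD exprM -[n in varpi_flat n]add0n varpi_flatX.
have Nk : (N.+1 <= p ^ N.+1)%N by apply/ltnW/ltn_expl/prime_gt1.
apply: (@tilt_reduced _ p_prime _ _ (p ^ k)); rewrite exprMn kE.
rewrite -(subnK Nk) exprD exprS -(prednK (n := p ^ k)) ?expn_gt0 ?p_gt0 //.
rewrite [x ^+ _]exprS -{2}(varpi_flatX 0 m) add0n.
rewrite -(prednK (n := p ^ m)) ?expn_gt0 ?p_gt0 // [varpi_flat m ^+ _]exprS.
set a := _ ^+ (_ - _); set b := _ ^+ (p ^ m).-1; set c := x ^+ _.
have -> : a * (varpi_flat m * b * varpi_flat 0 ^+ N) * (x * c)
  = a * b * c * (varpi_flat m * (varpi_flat 0 ^+ N * x)) by ring.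
by rewrite Nx mulr0.
Qed.

(* Write p^k a as a Witt vector xi w. Its first k components vanish, so each
   w_j with j < k is almost zero, and component k says that the leading
   coefficient of a is almost divisible by varpi, hence by p. *)
Lemma torsion_divides k a m : q ^+ k * a = 0 ->
  exists b, varpi m * a = varpi m * (q * b).
Proof.
move=> ka.
have [c cP] := expansion_ex p_prime q_complete Frobenius_surj a.
have := expansion_shift q_complete k cP; rewrite ka => /expansion0_kernel[w wP].
(* By induction xi_0 kills the earlier w_i, so xi_0 times the vanishing component j is xi_0
   xi_0^(p^j) w_j; then [varpi_flat_torsion] applies. *)
have w_tors j n : (j < k)%N -> varpi_flat n * w j = 0.
  elim/ltn_ind: j n => j IHj n jk.
  apply: (@varpi_flat_torsion 0 n (p ^ j)); rewrite varpi_flat0.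
  rewrite -(witt_mul_coef p_gt0) ?charB // => [|i ij].
    by rewrite -wP iter_scons_lt // expr0n expn_eq0 eqn0Ngt p_gt0 mulr0.
  by rewrite -varpi_flat0; apply: IHj => //; apply: ltn_trans jk.
have := wP k; rewrite iter_scons_eq => ck.
have wk : varpi_flat m * c 0%N ^+ (p ^ k)
    = varpi_flat m * (xi 0%N ^+ (p ^ k) * w k).
  rewrite ck; apply: (witt_mul_coef p_gt0); first exact: charB.
  by move=> j; apply: w_tors.
(* Taking p^k-th roots leaves a full factor xi_0, whose sharp is divisible by p. *)
have ckE : varpi_flat (m + k) * c 0%N
    = varpi_flat (m + k) * (varpi_flat 0 * troot k (w k)).
  apply: (@troot_inj _ p_prime _ k).
  by rewrite !exprMn varpi_flatX trootK varpi_flat0.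
have cE : varpi m * sharp (c 0%N) = varpi m * (varpi 0 * sharp (troot k (w k))).
  rewrite -!(sharpM q_complete) -(varpi_flatX m k).
  rewrite -(prednK (n := p ^ k)) ?expn_gt0 ?p_gt0 // exprSr -!mulrA.
  by congr (sharp (_ * _)).
have [b -> _] := expansion_head q_complete cP.
have [d dE] := divides_q_varpi.
exists (d * sharp (troot k (w k)) + b).
by rewrite mulrDr cE dE; ring.
Qed.

(* A torsion element is almost divisible by p, with a quotient which is again
   torsion; iterating, varpi (n+1) a lies in every p^k A. *)
Lemma varpi_torsion n a : varpi n * a = 0 -> varpi n.+1 * a = 0.
Proof.
move=> na.
have qa : q * a = 0.
  have [d ->] := divides_varpi_q.
  rewrite -(varpiX 0 n) add0n -(prednK (n := p ^ n)) ?expn_gt0 ?p_gt0 //.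
  by rewrite exprSr -mulrA -mulrA na !mulr0.
apply: q_complete.1 => k.
suff [b [-> _]] : exists b, varpi n.+1 * a = q ^+ k * b /\ q ^+ k.+1 * b = 0.
  exact: dividesMr (divides_refl _).
(* The induction is over all n, since each further factor p uses up a deeper root. *)
move: n.+1 => {}n {na}; elim: k n => [|k IHk] n.
  by exists (varpi n * a); rewrite mul1r expr1 mulrCA qa mulr0.
have [b [nb qb]] := IHk n.+1.
have [b' b'E] := torsion_divides n.+1 qb.
pose e := varpi n.+1 ^+ p.-2.
(* Possible since p >= 2: one factor is for the induction hypothesis, the other for
   [torsion_divides]. *)
have eE : varpi n = e * (varpi n.+1 * varpi n.+1).
  rewrite -(varpiX n 1) expn1 addn1 /e -expr2 -exprD.
  by case: (p) (prime_gt1 p_prime) => [|[]] //= k' _; rewrite addn2.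
exists (e * varpi n.+1 * b').
have E : varpi n * a = q ^+ k.+1 * (e * varpi n.+1 * b').
  rewrite eE -!mulrA nb [varpi n.+1 * (q ^+ k * b)]mulrCA b'E exprS; ring.
split=> //; rewrite [q ^+ k.+2]exprS -mulrA -E.
by rewrite mulrCA qa mulr0.
Qed.

End Kernel.

Lemma perfectoid_radical_p : perfectoid p_prime A ->
  exists g : nat -> A, [/\ forall n, g n = g n.+1 ^+ p,
    forall a, (exists n, divides q (a ^+ n)) <-> (exists n, divides (g n) a)
    & forall n a, g n * a = 0 -> g n.+1 * a = 0].
Proof.
move=> perfA; have q_complete := perfectoid_complete perfA.
have [pi_ex Frob [xi xiP]] := perfA.
exists (varpi xi); split.
- by move=> n; rewrite -(varpiX q_complete xi n 1) addn1 expn1.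
- move=> a; split=> [[n qa]|[n na]].
    exists n; apply: (radical_varpi q_complete Frob xiP pi_ex).
    apply: divides_trans qa (divides_expS a _).
    exact/ltnW/ltn_expl/prime_gt1.
  exists (p ^ n)%N; apply: divides_trans (divides_q_varpi q_complete xiP) _.
  by rewrite -(varpiX q_complete xi 0 n); apply: divides_exp.
- exact: varpi_torsion.
Qed.
End Perfectoid.

(** * Adjoining radicals one element at a time *)

Section MultiplicationTelescope.
Variable A : comPzRingType.
Implicit Types M N : lmodType A.

Fact scalel_linear M (a : A) : linear (fun m : M => a *: m).
Proof. by move=> b m m'; rewrite scalerDr !scalerA mulrC. Qed.

Definition scalel M (a : A) : {linear M -> M} := mklin (@scalel_linear M a).

(* The kernel of M -> N is the increasing union of the (g n) M. By the first two
   conditions, g n and e n have the same annihilator in M, so this union is the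
   colimit of M -> M -> ... along multiplication by the e n. *)
Definition telescopic M N : Prop :=
  exists (q : {linear M -> N}) (g e : nat -> A),
  [/\ forall n (m : M), g n *: m = g n.+1 *: (e n *: m),
      forall n (m : M), g n *: m = 0 -> e n *: m = 0,
      forall m, q m = 0 <-> exists n (m' : M), g n *: m' = m
    & forall z, exists m, q m = z].

Lemma pd_at_most_telescopic n M N : telescopic M N -> pd_at_most n M ->
  pd_at_most n.+2 N.
Proof.
move=> [q [g [e [ge g0 qE surj]]]].
exact: (pd_at_most_telescope (t := fun n => scalel M (g n)) (a := fun n =>
  scalel M (e n))) qE surj.
Qed.

Variables (R : comPzRingType) (phi : {rmorphism R -> A}).

Fact resl_linear M N (f : {linear M -> N}) :
  linear (f : restrict_scalars phi M -> restrict_scalars phi N).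
Proof. by move=> a x y; apply: (linearP f). Qed.

Definition resl M N (f : {linear M -> N}) :
  {linear restrict_scalars phi M -> restrict_scalars phi N} :=
  mklin (resl_linear f).

Lemma id_at_most_telescopic n M N : noetherian R -> telescopic M N ->
  id_at_most n (restrict_scalars phi M) -> id_at_most n (restrict_scalars phi
    N).
Proof.
move=> R_noeth [q [g [e [ge g0 qE surj]]]].
exact: (id_at_most_telescope R_noeth (t := fun n => resl (scalel M (g n)))
  (a := fun n => resl (scalel M (e n))) (q := resl q)) ge g0 qE surj.
Qed.

Lemma projective_regular : projective (A^o : lmodType A).
Proof.
move=> M N g f surj; have [m mE] := surj (f 1).
have hL : linear (fun a : A^o => (a : A) *: m).
  by move=> a b c; rewrite scalerDl scalerA.
exists (mklin hL) => a; rewrite /= linearZ mE -linearZ.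
by congr (f _); apply: mulr1.
Qed.

End MultiplicationTelescope.

(** * Radical ideals and their quotients as modules *)

Section Ideals.
Variable A : comPzRingType.
Implicit Types (I J : ideal A) (S : set A).

Lemma ideal_ext I J : (forall x, I x <-> J x) -> I = J.
Proof.
case: I J => [I I0 Iadd IM] [J J0 JD JM] /= IJ.
have E : I = J by apply/funext => x; apply/propext.
by case: _ / E in J0 JD JM *; congr Ideal; apply: Prop_irrelevance.
Qed.

Lemma gen_ideal_incl S x : S x -> gen_ideal S x.
Proof. by move=> Sx J; apply. Qed.

Lemma gen_ideal_sub S J x : (S `<=` J)%classic -> gen_ideal S x -> J x.
Proof. by move=> SJ; apply. Qed.

Lemma radical_sub I x : I x -> radical I x.
Proof. by move=> Ix; exists 1%N; rewrite expr1. Qed.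

Lemma radical_idem I x n : radical I (x ^+ n) -> radical I x.
Proof. by move=> [k xk]; exists (n * k)%N; rewrite exprM. Qed.

Lemma gen_idealU1 S f x : gen_ideal (fun y => S y \/ y = f) x ->
  exists c, gen_ideal S (x - c * f).
Proof.
pose K y := exists c, gen_ideal S (y - c * f).
have K0 : K 0 by exists 0; rewrite mul0r subrr; apply: ideal0.
have KD y z : K y -> K z -> K (y + z).
  move=> [c yc] [d zd]; exists (c + d).
  by rewrite mulrDl opprD addrACA; apply: idealD.
have KM a y : K y -> K (a * y).
  by move=> [c yc]; exists (a * c); rewrite -mulrA -mulrBr; apply: idealMl.
move=> /(_ (Ideal K0 KD KM)); apply=> y [Sy|->] /=.
  by exists 0; rewrite mul0r subr0; apply: gen_ideal_incl.
by exists 1; rewrite mul1r subrr; apply: ideal0.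
Qed.

Lemma gen_ideal1 (a x : A) : gen_ideal [set a] x <-> divides a x.
Proof.
split=> [|[c ->] J aJ]; last exact/idealMl/aJ.
move=> /(_ (Ideal (divides0 a) (@dividesD _ a) (@dividesMl _ a))).
by apply=> _ ->; apply: divides_refl.
Qed.

Fact proj_linear J : linear (proj J : A^o -> quot J).
Proof. by move=> a x y; rewrite projD projM. Qed.

Definition projl J : {linear A^o -> quot J} := locked (mklin (@proj_linear J)).

Lemma projlP J x y : projl J x = projl J y <-> J (x - y).
Proof. by rewrite /projl -lock; apply: projP. Qed.

Lemma projl_surj J z : exists x, projl J x = z.
Proof. by rewrite /projl -lock; exists (repr z); apply: reprK_proj. Qed.

Lemma projl_eq0 J x : projl J x = 0 <-> J x.
Proof. by rewrite -(linear0 (projl J)) projlP subr0. Qed.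

End Ideals.

Section PerfectoidSteps.
Variables (p : nat) (p_prime : prime p) (A : comPzRingType).
Hypothesis A_perfectoid : perfectoid p_prime A.
Implicit Types J : ideal A.
Local Notation q := (p%:R : A).

Lemma telescopic_radical_p J : (forall x, J x <-> radical (gen_ideal [set q])
  x) ->
  telescopic (A^o : lmodType A) (quot J).
Proof.
move=> JE; have [g [gp gE g0]] := perfectoid_radical_p A_perfectoid.
exists (projl J), g, (fun n => g n.+1 ^+ p.-1); split.
- move=> n m; by rewrite scalerA -exprS prednK ?prime_gt0 // gp.
(* As p >= 2, the power g_(n+1)^(p-1) contains a factor g_(n+1), which kills m. *)
- move=> n m /g0 gm; case: (p) (prime_gt1 p_prime) => [|[|k]] //= _.
  by rewrite exprSr -scalerA [_ *: m]gm scaler0.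
- move=> m; rewrite projl_eq0 JE; split=> [[k /gen_ideal1 km]|[n [m' <-]]].
    have /gE[n [c mE]] : exists n, divides q (m ^+ n) by exists k.
    by exists n, c; rewrite mE mulrC.
  have /gE[k qk] : exists n', divides (g n') (g n * m').
    by exists n; apply/dividesMr/divides_refl.
  by exists k; apply/gen_ideal1.
- exact: projl_surj.
Qed.

Lemma Frobenius_iterB N (a b : A) :
  divides q ((a - b) ^+ (p ^ N) - (a ^+ (p ^ N) - b ^+ (p ^ N))).
Proof.
apply/prP; elim: N => [|N IHN]; first by rewrite !expr1.
rewrite expnSr !exprM rmorphXn /= IHN !rmorphB /=.
by rewrite (modp_FrobeniusB p_prime) -!rmorphXn.
Qed.

Variables (J J' : ideal A) (f : A).
Hypothesis J_p : J q.
Hypothesis J_rad : forall x n, J (x ^+ n) -> J x.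
Hypothesis JJ' : forall x, J x -> J' x.
Hypothesis J'_f : J' f.
Hypothesis J'_rad : forall x n, J' (x ^+ n) -> J' x.
Hypothesis J'_sub : forall x, J' x -> exists n c, J (x ^+ n - c * f).

Let J_divides x : divides q x -> J x.
Proof. by move=> [c ->]; apply: idealMl. Qed.

(** Frobenius on A/J is surjective because p lies in J and injective because J is radical. The roots
    of f are lifted to A, so their relations hold modulo J only. *)
Lemma telescopic_root : telescopic (quot J : lmodType A) (quot J').
Proof.
have [_ Frob _] := A_perfectoid.
have Jsub x y z : J (x - y) -> J (y - z) -> J (x - z).
  by move=> xy yz; rewrite -(subrK y x) -addrA; apply: idealD.
have /choice[s sP] a : exists b, J (b ^+ p - a).
  have [b bE] := Frob (pr p a); exists (repr b); apply: J_divides.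
  by apply/prP; rewrite rmorphXn /= pr_repr.
have iter_s a n : J (iter n s a ^+ (p ^ n) - a).
  elim: n => [|n IHn]; first by rewrite expr1 subrr; apply: ideal0.
  apply: Jsub IHn; rewrite expnS exprM /= subrXX mulrC.
  exact/idealMl/sP.
pose g n := iter n s f; pose e n := g n.+1 ^+ p.-1.
have geE n : g n.+1 * e n = g n.+1 ^+ p by rewrite -exprS prednK ?prime_gt0.
have J'g n : J' (g n).
  apply: (J'_rad (n := p ^ n)); rewrite -[_ ^+ _](subrK f).
  by apply: idealD => //; apply/JJ'/iter_s.
have [qJ qJE] : exists h : {linear quot J -> quot J'},
    forall x, h (projl J x) = projl J' x.
  apply: ex_desc; first exact: projl_surj.
  by move=> x /projl_eq0 Jx; apply/projl_eq0/JJ'.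
have scaleE a x : a *: projl J x = projl J (a * x) by rewrite -linearZ.
exists qJ, g, e; split.
- move=> n m; have [x <-] := projl_surj m; rewrite !scaleE mulrA geE.
  apply/projlP; rewrite -mulrBl mulrC; apply: idealMl.
  by rewrite -opprB; apply/idealN/sP.
- move=> n m; have [x <-] := projl_surj m; rewrite !scaleE !projl_eq0 => gx.
  (* The p-th power of this product is g_n x times x^(p-1) modulo J, and J is radical. *)
  have Jgx : J (g n.+1 * x).
    apply: (J_rad (n := p));
      rewrite exprMn -[p in x ^+ p]prednK ?prime_gt0 // exprS.
    rewrite mulrA mulrC; apply: idealMl.
    rewrite -[g n.+1 ^+ p](subrK (g n)) mulrDl; apply: idealD => //.
    by rewrite mulrC; apply/idealMl/sP.
  rewrite /e; case: (p) (prime_gt1 p_prime) => [|[|k]] //= _.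
  by rewrite exprSr -mulrA; apply: idealMl.
- move=> m; have [x <-] := projl_surj m; rewrite qJE projl_eq0; split;
    last first.
    move=> [n [m']]; have [y <-] := projl_surj m';
      rewrite scaleE => /projlP gyx.
    rewrite -[x](subKr (g n * y)); apply: idealB; last exact: JJ'.
    by rewrite mulrC; apply: idealMl.
  move=> /J'_sub[k [c xc]].
  have kN : (k <= p ^ k)%N by apply/ltnW/ltn_expl/prime_gt1.
  (* Raising the exponent from k to p^k makes Frobenius invertible on the relation: x^(p^k) is c' f
     modulo J, so x is congruent to g_k y, where y is a p^k-th root of c'. *)
  pose c' := x ^+ (p ^ k - k) * c; pose y := iter k s c'.
  exists k, (projl J y); rewrite scaleE; apply/projlP.
  rewrite -opprB; apply/idealN/(J_rad (n := p ^ k)).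
  rewrite -[_ ^+ _](subrK (x ^+ (p ^ k) - (g k * y) ^+ (p ^ k))).
  apply: idealD; first exact/J_divides/Frobenius_iterB.
  apply: (Jsub _ (c' * f)).
    have -> : x ^+ (p ^ k) - c' * f = x ^+ (p ^ k - k) * (x ^+ k - c * f).
      by rewrite mulrBr -exprD subnK // mulrA.
    exact: idealMl.
  rewrite -opprB exprMn; apply: idealN.
  have -> : g k ^+ (p ^ k) * y ^+ (p ^ k) - c' * f
    = y ^+ (p ^ k) * (g k ^+ (p ^ k) - f) + f * (y ^+ (p ^ k) - c') by ring.
  by apply: idealD; apply/idealMl/iter_s.
- move=> z; have [x <-] := projl_surj z; exists (projl J x); exact: qJE.
Qed.

End PerfectoidSteps.

(** * Chaining the r + 1 passages *)

Theorem corollary1p1 (p : nat) (p_prime : prime p)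
  (R A : comPzRingType) (phi : {rmorphism R -> A})
  (R_noetherian : noetherian R) (A_perfectoid : perfectoid p_prime A)
  (I : ideal R) (p_in_I : I p%:R)
  (r : nat) (I_gen : generated_up_to_radical I r) :
  let J := radical (extended_ideal phi I) in
  proj_dim_le (quot J : lmodType A) (2 * (r + 1))%N
  /\ ((exists n, inj_dim_le (restrict_scalars phi A^o) n) ->
      forall n, inj_dim_le (restrict_scalars phi A^o) n ->
                inj_dim_le (restrict_scalars phi (quot J)) n).
Proof.
move=> J; have [f fP] := I_gen.
(* Placing p in every generating set makes all the quotients by [Jk k] rings of characteristic p. *)
pose S k : set A := fun x => x = p%:R \/ exists2 i : 'I_r, (i < k)%N & x = phi
  (f i).
pose Jk k := radical (gen_ideal (S k)).
have tele0 : telescopic (A^o : lmodType A) (quot (Jk 0%N)).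
  apply: (telescopic_radical_p A_perfectoid) => x.
  suff S0 : S 0%N = [set (p%:R : A)]%classic by rewrite /Jk S0.
  by apply/seteqP; split=> y => [[->|[]]|->] //; left.
have teleS k : (k < r)%N -> telescopic (quot (Jk k) : lmodType A) (quot (Jk
  k.+1)).
  move=> kr; pose i := Ordinal kr.
  have SS : S k.+1 = (fun y => S k y \/ y = phi (f i)).
    apply/funext => y; apply/propext;
      split=> [[->|[j jk ->]]|[[->|[j jk ->]]|->]].
    - by left; left.
    - move: jk; rewrite ltnS leq_eqVlt => /orP[/eqP jk|jk]; last by left;
        right; exists j.
      by right; congr (phi (f _)); apply: val_inj.
    - by left.
    - by right; exists j => //; apply: ltnW.
    - by right; exists i.
  apply: (telescopic_root A_perfectoid (f := phi (f i))).
  - by apply/radical_sub/gen_ideal_incl; left.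
  - by move=> x n; apply: radical_idem.
  - move=> x [n xn]; exists n; apply: gen_ideal_sub xn => y Sy.
    by apply: gen_ideal_incl; rewrite SS; left.
  - by apply/radical_sub/gen_ideal_incl; rewrite SS; right.
  - by move=> x n; apply: radical_idem.
  - move=> x [n]; rewrite SS => /gen_idealU1[c xc].
    by exists n, c; apply: radical_sub.
have JE : Jk r = J.
  apply: ideal_ext => x; split=> [[n xn]|[n xn]];
    apply: (radical_idem (n := n)).
    apply: gen_ideal_sub xn => _ [->|[i _ ->]].
      apply/radical_sub/gen_ideal_incl; exists p%:R => //; exact: rmorph_nat.
    (* The generator [f i] is only known to have a power in I. *)
    have /fP[m fm] : radical (gen_ideal (range f)) (f i).
      by apply/radical_sub/gen_ideal_incl; exists i.
    by apply: (radical_idem (n := m)); apply/radical_sub/gen_ideal_incl;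
      exists (f i ^+ m); rewrite ?rmorphXn.
  apply: gen_ideal_sub xn => _ [y Iy <-].
  have /fP[m ym] := radical_sub Iy.
  exists m; rewrite -rmorphXn.
  (* The contraction to R of the ideal generated by [S r]; it contains every [f i]. *)
  pose K y := gen_ideal (S r) (phi y).
  have K0 : K 0 by rewrite /K rmorph0; apply: ideal0.
  have KD a b : K a -> K b -> K (a + b) by rewrite /K rmorphD; apply: idealD.
  have KM a b : K b -> K (a * b) by rewrite /K rmorphM; apply: idealMl.
  apply: (gen_ideal_sub (J := Ideal K0 KD KM)) ym => _ [i _ <-].
  by apply: gen_ideal_incl; right; exists i.
split=> [|_ n /inj_dim_le_at_most idA].
  suff PDk k : (k <= r)%N -> pd_at_most (2 * k.+1) (quot (Jk k) : lmodType A).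
    by apply: pd_at_most_proj_dim_le; rewrite addn1 -JE; apply: PDk.
  elim: k => [_|k IHk kr].
    by apply: pd_at_most_telescopic tele0 _; apply: projective_regular.
  by rewrite mulnS; apply: pd_at_most_telescopic (teleS _ kr) _; apply/IHk/ltnW.
suff IDk k : (k <= r)%N -> id_at_most n (restrict_scalars phi (quot (Jk k))).
  by apply: id_at_most_inj_dim_le; rewrite -JE; apply: IDk.
elim: k => [_|k IHk kr]; first exact: id_at_most_telescopic tele0 idA.
by apply: id_at_most_telescopic (teleS _ kr) _ => //; apply/IHk/ltnW.
Qed.
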